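(* Let $A$ be an Artin algebra and $n\ge 0$ an integer. The following are equivalent. (1) $A$ is $n$-Gorenstein; (2) $\operatorname{grade}_A S\ge \min\{n,\operatorname{pdim}_A I(S)\}$ for each simple $A$-module $S$; (3) $\operatorname{pdim}_A I(S)=\operatorname{grade}_A S$ for each simple $A$-module $S$ with $\operatorname{grade}_A S<n$.
   Context: All modules are left modules. An Artin algebra is an algebra that is module finite over a commutative Artinian ring. $I(S)$ denotes the injective envelope of $S$; $\operatorname{pdim}$ and $\operatorname{fdim}$ denote projective and flat dimension. For a finitely generated $A$-module $X$, $\operatorname{grade}_A X=\min\{i\ge 0\mid \operatorname{Ext}_A^i(X,A)\ne 0\}$, with $\min\emptyset=\infty$. Let $0\to A\to I^0(A)\to I^1(A)\to\cdots$ be a minimal injective coresolution of the left module $A$. $A$ is $n$-Gorenstein if $\operatorname{fdim}_A I^g(A)\le g$ for all $0\le g<n$. *)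

(* Defs.v *)
From HB Require Import structures.
From mathcomp Require Import all_boot all_order all_algebra.
From mathcomp Require Import boolp constructive_ereal.

Set Implicit Arguments.
Unset Strict Implicit.
Unset Printing Implicit Defensive.

Import Order.TTheory GRing.Theory Num.Theory.
Local Open Scope ring_scope.

(* [least P] is the minimum of [P] in N \cup {+oo}, with min \emptyset = +oo.
   N \cup {+oo} is embedded in the library's extended integers. *)
Definition least (P : nat -> Prop) : \bar int :=
  match pselect (exists n, `[< P n >]) with
  | left exP => EFin (ex_minn exP)%:Z
  | right _ => +oo%E
  end.

Definition artinian (R : pzRingType) : Prop :=
  forall J : nat -> {pred R^o},
    (forall i, submod_closed (J i)) ->
    (forall i, {subset J i.+1 <= J i}) ->
    exists m, forall i, (m <= i)%N -> J i =i J m.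

(* The algebra structure is given by a central ring morphism [phi : k -> A]:
   the library's [algType k] would exclude the zero algebra. *)
Definition artin_algebra (A : pzRingType) : Prop :=
  exists (k : comPzRingType) (phi : {rmorphism k -> A}),
    [/\ artinian k,
        forall c a, phi c * a = a * phi c
      & exists s : seq A, forall a, exists c : nat -> k,
          a = \sum_(i < size s) phi (c i) * s`_i].

Section Modules.
Variable A : pzRingType.

Definition exact_at (U V W : lmodType A) (f : U -> V) (g : V -> W) : Prop :=
  forall v, g v = 0 <-> exists u, f u = v.

Definition simple_module (S : lmodType A) : Prop :=
  (exists x : S, x != 0) /\
  forall U : {pred S}, submod_closed U ->
    (forall x, x \in U -> x = 0) \/ (forall x, x \in U).

Definition projective_module (P : lmodType A) : Prop :=
  forall (M N : lmodType A) (p : {linear M -> N}) (f : {linear P -> N}),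
    (forall y, exists x, p x = y) ->
    exists g : {linear P -> M}, forall x, p (g x) = f x.

Definition injective_module (E : lmodType A) : Prop :=
  forall (M N : lmodType A) (i : {linear M -> N}) (f : {linear M -> E}),
    injective i ->
    exists g : {linear N -> E}, forall x, g (i x) = f x.

(* Right modules are left modules over the converse ring [A^c]. *)
Definition balanced (M : lmodType A^c) (E : lmodType A) (T : zmodType)
    (b : M -> E -> T) : Prop :=
  [/\ forall m m' x, b (m + m') x = b m x + b m' x,
      forall m x x', b m (x + x') = b m x + b m x'
    & forall (a : A) m x, b ((a : A^c) *: m) x = b m (a *: x)].

Definition is_tensor_product (M : lmodType A^c) (E : lmodType A) (T : zmodType)
    (t : M -> E -> T) : Prop :=
  balanced t /\
  forall (G : zmodType) (b : M -> E -> G), balanced b ->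
    (exists h : {additive T -> G}, forall m x, h (t m x) = b m x) /\
    (forall h h' : {additive T -> G},
       (forall m x, h (t m x) = h' (t m x)) -> h =1 h').

(* [h] below is the induced map f (x) E : M (x) E -> N (x) E. *)
Definition flat_module (E : lmodType A) : Prop :=
  forall (M N : lmodType A^c) (f : {linear M -> N}), injective f ->
  forall (T T' : zmodType) (t : M -> E -> T) (t' : N -> E -> T'),
    is_tensor_product t -> is_tensor_product t' ->
  forall h : {additive T -> T'},
    (forall m x, h (t m x) = t' (f m) x) -> injective h.

(* ... -> P_1 -> P_0 -> X -> 0 exact, with all P_i in the class C. *)
Record resolution (C : lmodType A -> Prop) (X : lmodType A) := Resolution {
  res_term :> nat -> lmodType A;
  res_diff : forall i, {linear res_term i.+1 -> res_term i};
  res_aug : {linear res_term 0 -> X};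
  res_class : forall i, C (res_term i);
  res_aug_surj : forall x, exists p, res_aug p = x;
  res_exact0 : exact_at (res_diff 0) res_aug;
  res_exact : forall i, exact_at (res_diff i.+1) (res_diff i)
}.

(* The zero module has dimension 0 here. *)
Definition resolution_dim (C : lmodType A -> Prop) (X : lmodType A) :
    \bar int :=
  least (fun n => exists P : resolution C X,
                    forall i, (n < i)%N -> forall x : P i, x = 0).

Definition pdim (X : lmodType A) : \bar int :=
  resolution_dim projective_module X.

Definition fdim (X : lmodType A) : \bar int :=
  resolution_dim flat_module X.

(* Cocycles and coboundaries of the complex Hom_A(P, M). *)
Definition cocycle (X M : lmodType A) (P : resolution projective_module X)
    (i : nat) (f : {linear P i -> M}) : Prop :=
  forall x, f (res_diff P i x) = 0.

Definition coboundary (X M : lmodType A) (P : resolution projective_module X)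
    (i : nat) : {linear P i -> M} -> Prop :=
  match i return {linear P i -> M} -> Prop with
  | 0 => fun f => forall x, f x = 0
  | j.+1 => fun f => exists g : {linear P j -> M},
                       forall x, f x = g (res_diff P j x)
  end.

(* Ext_A^i(X, M) <> 0, where Ext is the cohomology of Hom_A(P, M), which does
   not depend on the projective resolution P of X up to isomorphism. *)
Definition Ext_nonzero (i : nat) (X M : lmodType A) : Prop :=
  exists (P : resolution projective_module X) (f : {linear P i -> M}),
    cocycle f /\ ~ coboundary f.

Definition grade (X : lmodType A) : \bar int :=
  least (fun i => Ext_nonzero i X A^o).

(* Every nonzero submodule of V meets the image of f nontrivially. *)
Definition essential_image (U V : lmodType A) (f : U -> V) : Prop :=
  forall W : {pred V}, submod_closed W -> (exists2 w, w \in W & w != 0) ->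
    exists u, f u \in W /\ f u != 0.

Definition injective_envelope (X E : lmodType A) (f : {linear X -> E}) : Prop :=
  [/\ injective_module E, injective f & essential_image f].

(* 0 -> X -> I^0 -> I^1 -> ... exact, where I^0 is an injective envelope of X
   and each I^(i+1) is an injective envelope of the image of I^i. *)
Record min_inj_coresolution (X : lmodType A) := MinInjCoresolution {
  cores_term :> nat -> lmodType A;
  cores_aug : {linear X -> cores_term 0};
  cores_diff : forall i, {linear cores_term i -> cores_term i.+1};
  cores_injective : forall i, injective_module (cores_term i);
  cores_aug_inj : injective cores_aug;
  cores_exact0 : exact_at cores_aug (cores_diff 0);
  cores_exact : forall i, exact_at (cores_diff i) (cores_diff i.+1);
  cores_aug_min : essential_image cores_aug;
  cores_min : forall i, essential_image (cores_diff i)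
}.

(* Minimal injective coresolutions exist and are unique up to isomorphism. *)
Definition n_Gorenstein (n : nat) : Prop :=
  forall I : min_inj_coresolution A^o,
  forall g : nat, (g < n)%N -> (fdim (I g) <= EFin g%:Z)%E.

End Modules.

(* Main.v *)
(* Over a left Artinian ring flat modules are projective, so flat and projective
   dimensions agree. Minimality of the coresolution I of A gives
   Ext^g(S, A) = Hom(S, I^g) for S simple, so Ext^g(S, A) <> 0 exactly when the
   injective envelope I(S) is a direct summand of I^g. This turns
   fdim I^g <= g into pdim I(S) <= g for all such S; for the converse, I^g is
   exhausted by the envelopes of its simple submodules, sums of which remain
   injective because A is left Noetherian, and pdim <= g is expressed as a
   lifting property that can be checked on them one at a time. Finally
   grade S <= pdim I(S) always holds: if Ext^i(S, A) = 0 for all i <= m, then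
   dimension shifting along a projective resolution of length m of I(S) gives
   Hom(S, I(S)) = 0. *)
Require Import Defs.
From HB Require Import structures.
From mathcomp Require Import all_boot all_order all_algebra.
From mathcomp Require Import boolp classical_sets functions constructive_ereal.

Set Implicit Arguments.
Unset Strict Implicit.
Unset Printing Implicit Defensive.

Import Order.TTheory GRing.Theory Num.Theory.
Local Open Scope classical_set_scope.
Local Open Scope ring_scope.

(** * Submodules, quotients and Zorn's lemma *)

(** The Artin hypothesis enters through the descending chain condition on left ideals, and no
    duality is used to keep injective envelopes finitely generated. A projective resolution of I(S)
    may therefore involve arbitrary projectives F, and Ext^i(S, A) = 0 must be carried over to
    Ext^i(S, F) = 0. This is where S needs a resolution by finitely generated projectives, hence a
    left Noetherian ring: a map from such a term meets only finitely many coordinates of a dual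
    basis of F. Likewise I^g is not decomposed into indecomposable summands; a partial lift with
    injective domain is enlarged by Zorn's lemma, and a maximal one would still grow by the hull of
    a simple submodule. That flat modules are projective rests on the nilpotency of the radical J: a
    surjection onto a flat module is split one layer of its kernel at a time, the layers being
    killed by J. The vanishing of Ext^(g+1)(M, -) is a lifting property of M against g-th
    cosyzygies, a form in which it passes to direct summands and can be glued from submodules. *)

Definition submod (R : pzRingType) (V : lmodType R) (U : set V) : Prop :=
  U 0 /\ forall a x y, U x -> U y -> U (a *: x + y).

Lemma exists_linear (R : pzRingType) (U V : lmodType R) (f : U -> V) :
  linear f -> exists g : {linear U -> V}, forall x, g x = f x.
Proof.
move=> lf; pose L := GRing.isLinear.Build R U V _ f lf.
by exists (HB.pack f L : {linear U -> V}).
Qed.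

Section Submod.
Variables (R : pzRingType) (V : lmodType R).
Implicit Types (U : set V) (x y : V) (a : R).

Lemma submod0 U : submod U -> U 0.
Proof. by case. Qed.

Lemma submodD U x y : submod U -> U x -> U y -> U (x + y).
Proof. by move=> [_ UD] Ux Uy; rewrite -[x]scale1r; apply: UD. Qed.

Lemma submodZ U a x : submod U -> U x -> U (a *: x).
Proof. by move=> [U0 UD] Ux; rewrite -[_ *: _]addr0; apply: UD. Qed.

Lemma submodN U x : submod U -> U x -> U (- x).
Proof. by move=> sU Ux; rewrite -scaleN1r; apply: submodZ. Qed.

Lemma submodB U x y : submod U -> U x -> U y -> U (x - y).
Proof. by move=> sU Ux Uy; apply: submodD => //; apply: submodN. Qed.

Lemma submod_sum U (I : eqType) (r : seq I) (F : I -> V) :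
  submod U -> (forall i, i \in r -> U (F i)) -> U (\sum_(i <- r) F i).
Proof.
move=> sU UF; rewrite big_seq; elim/big_rec: _ => [|i x ir Ux].
  exact: submod0.
by apply: submodD => //; apply: UF.
Qed.

Lemma submod_closedP (U : {pred V}) :
  submod_closed U <-> submod [set x | x \in U].
Proof.
by split=> -[U0 UD]; split=> //= a x y Ux Uy; apply: UD.
Qed.

Lemma submod_pred U : submod U -> submod_closed [pred x | `[< U x >]].
Proof.
move=> [U0 UD]; split=> [|a x y /asboolP Ux /asboolP Uy].
  by apply/asboolP.
by apply/asboolP/UD.
Qed.

Lemma submod_setT : submod [set: V].
Proof. by split. Qed.

Lemma submod_set0 : submod [set 0 : V].
Proof. by split=> // a x y /= -> ->; rewrite scaler0 addr0. Qed.

Lemma submodI U W : submod U -> submod W -> submod [set x | U x /\ W x].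
Proof.
move=> [U0 UD] [W0 WD]; split=> //= a x y [? ?] [? ?].
by split; [apply: UD|apply: WD].
Qed.

Definition sumset U (W : set V) : set V :=
  [set x | exists u w, [/\ U u, W w & x = u + w]].

Lemma submod_sumset U W : submod U -> submod W -> submod (sumset U W).
Proof.
move=> [U0 UD] [W0 WD]; split; first by exists 0, 0; rewrite addr0.
move=> a _ _ [u [w [Uu Ww ->]]] [u' [w' [Uu' Ww' ->]]].
exists (a *: u + u'), (a *: w + w'); split; [exact: UD|exact: WD|].
by rewrite scalerDr addrACA.
Qed.

Lemma sumset_l U W x : submod W -> U x -> sumset U W x.
Proof. by move=> [W0 _] Ux; exists x, 0; rewrite addr0. Qed.

Lemma sumset_r U W x : submod U -> W x -> sumset U W x.
Proof. by move=> [U0 _] Wx; exists 0, x; rewrite add0r. Qed.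

Lemma sumset_sub U W U' : submod U' ->
  (forall x, U x -> U' x) -> (forall x, W x -> U' x) ->
  forall x, sumset U W x -> U' x.
Proof. by move=> sU' UU' WU' _ [u [w [/UU' ? /WU' ? ->]]]; apply: submodD. Qed.

Definition cyclic x : set V := [set y | exists a, y = a *: x].

Lemma submod_cyclic x : submod (cyclic x).
Proof.
split; first by exists 0; rewrite scale0r.
by move=> a _ _ [b ->] [c ->]; exists (a * b + c); rewrite scalerDl scalerA.
Qed.

Lemma cyclicP x : cyclic x x.
Proof. by exists 1; rewrite scale1r. Qed.

Lemma cyclic_sub U x : submod U -> U x -> forall y, cyclic x y -> U y.
Proof. by move=> sU Ux _ [a ->]; apply: submodZ. Qed.

Lemma submod_bigcup (C : set (set V)) : (exists U, C U) ->
  (forall U, C U -> submod U) -> total_on C subset ->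
  submod (\bigcup_(U in C) U).
Proof.
move=> [U0 CU0] sC totC; split; first by exists U0 => //; apply: submod0; auto.
move=> a x y [U CU Ux] [W CW Wy]; have [UW|WU] := totC _ _ CU CW.
  by exists W => //; case: (sC _ CW) => _; apply => //; apply: UW.
by exists U => //; case: (sC _ CU) => _; apply => //; apply: WU.
Qed.

(** The common source of the maximality arguments below: essential extensions, complements, graphs
    of partial maps, left ideals. Only nonempty chains of submodules above [U0] have to be
    examined. *)
Lemma submod_zorn (P : set V -> Prop) (U0 : set V) : submod U0 -> P U0 ->
  (forall C : set (set V), (exists U, C U) ->
     (forall U, C U -> [/\ submod U, (U0 `<=` U) & P U]) ->
     total_on C subset -> P (\bigcup_(U in C) U)) ->
  exists U, [/\ submod U, (U0 `<=` U), P U &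
    forall W, submod W -> (U `<=` W) -> P W -> (W `<=` U)].
Proof.
move=> sU0 PU0 chainP.
(* The empty set is added so that the empty chain causes no trouble. *)
pose Q U := (forall x, ~ U x) \/ [/\ submod U, (U0 `<=` U) & P U].
have [F QF totF|U [QU maxU]] := @Zorn_bigcup V Q.
  pose C := [set U | F U /\ exists x, U x].
  have eqFC : (\bigcup_(U in F) U = \bigcup_(U in C) U).
    apply/seteqP; split=> x [U FU Ux]; last by exists U => //; case: FU.
    by exists U => //; split=> //; exists x.
  have [neC|eC] := pselect (exists U, C U); last first.
    by left=> x; rewrite eqFC => -[U CU _]; apply: eC; exists U.
  have QC U : C U -> [/\ submod U, (U0 `<=` U) & P U].
    by move=> [/QF[nU|//] [x /nU]].
  have totC : total_on C subset by move=> U W [FU _] [FW _]; apply: totF.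
  right; rewrite eqFC; split; last exact: chainP.
    by apply: submod_bigcup => // U /QC[].
  have [U CU] := neC => x U0x; exists U => //.
  by have [_ U0U _] := QC _ CU; exact: U0U.
have {QU}[sU U0U PU] : [/\ submod U, (U0 `<=` U) & P U].
  case: QU => // nU; exfalso; apply: (maxU U0); last by right; split.
  split=> [x /nU//|U0U]; apply: (nU 0); apply: U0U; exact: submod0.
exists U; split=> // W sW UW PW; apply: contrapT => nWU.
by apply: (maxU W) => //; right; split=> //; apply: subset_trans UW.
Qed.

End Submod.

Lemma submod_preim (R : pzRingType) (V W : lmodType R) (f : {linear V -> W})
  (U : set W) : submod U -> submod [set x | U (f x)].
Proof.
move=> [U0 UD]; split; first by rewrite /= linear0.
by move=> a x y Ux Uy /=; rewrite linearP; apply: UD.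
Qed.

Lemma submod_im (R : pzRingType) (V W : lmodType R) (f : {linear V -> W})
  (U : set V) : submod U -> submod [set y | exists2 x, U x & y = f x].
Proof.
move=> [U0 UD]; split; first by exists 0 => //; rewrite linear0.
move=> a _ _ [x Ux ->] [y Uy ->]; exists (a *: x + y); first exact: UD.
by rewrite linearP.
Qed.

Lemma linear_eq0_inj (R : pzRingType) (V W : lmodType R) (f : {linear V -> W}) :
  (forall x, f x = 0 -> x = 0) -> injective f.
Proof.
move=> f0 x y fxy; apply/eqP; rewrite -subr_eq0; apply/eqP/f0.
by rewrite linearB fxy subrr.
Qed.

Section SubmoduleObject.
Variables (R : pzRingType) (V : lmodType R) (U : {pred V}).
Hypothesis sU : submod_closed U.

Definition submodule_pred : V -> bool := fun x => x \in U.
HB.instance Definition _ := GRing.isSubmodClosed.Build R V submodule_pred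
  (GRing.submod_closed_semi sU).

Record submodule := Submodule { submodule_val : V; _ : submodule_pred submodule_val }.
HB.instance Definition _ := [isSub for submodule_val].
HB.instance Definition _ := [Choice of submodule by <:].
HB.instance Definition _ := [SubChoice_isSubLmodule of submodule by <:].

Definition submodule_lmod : lmodType R := submodule.
Definition submodule_incl : {linear submodule_lmod -> V} :=
  (val : submodule -> V).

End SubmoduleObject.

Lemma exists_submodule (R : pzRingType) (V : lmodType R) (U : set V) :
  submod U -> exists (W : lmodType R) (i : {linear W -> V}),
    injective i /\ forall x, U x <-> exists w, i w = x.
Proof.
move=> /submod_pred sU; exists (submodule_lmod sU), (submodule_incl sU).
split; first exact: val_inj.
move=> x; split=> [Ux|[[w /= Uw] <-]]; last exact/asboolP.
have px : submodule_pred [pred x | `[< U x >]] x by apply/asboolP.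
by exists (Submodule px).
Qed.

Section QuotientObject.
Variables (R : pzRingType) (V : lmodType R) (U : set V).
Hypothesis sU : submod U.

(** A canonical point of each coset. The quotient is then the subtype of fixed points of
    [quotient_repr] and inherits its choice structure from [V]. *)
Definition quotient_repr (x : V) : V := choose (fun y => `[< U (y - x) >]) x.

Lemma quotient_reprP x : U (quotient_repr x - x).
Proof.
apply/asboolP; apply: (chooseP (P := fun y => `[< U (y - x) >])).
apply/asboolP; rewrite subrr; exact: submod0.
Qed.

Lemma quotient_reprE x y : U (x - y) -> quotient_repr x = quotient_repr y.
Proof.
move=> Uxy; rewrite /quotient_repr.
rewrite (@eq_choose _ _ (fun z => `[< U (z - y) >])); last first.
  move=> z; apply: asbool_equiv_eq; split=> Uz.
    by rewrite -(subrK x z) -addrA; apply: submodD.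
  by rewrite -(subrK y z) -addrA -(opprB x y); apply: submodB.
by apply: choose_id; apply/asboolP; rewrite ?subrr //; apply: submod0.
Qed.

Record quotient := Quotient { quotient_val : V;
  _ : quotient_repr quotient_val == quotient_val }.
HB.instance Definition _ := [isSub for quotient_val].
HB.instance Definition _ := [Choice of quotient by <:].

Definition quotient_proj (x : V) : quotient.
exists (quotient_repr x); apply/eqP/quotient_reprE/quotient_reprP.
Defined.

Lemma quotient_proj_eq x y : quotient_proj x = quotient_proj y <-> U (x - y).
Proof.
split=> [/(congr1 val)/= exy|/quotient_reprE e]; last exact: val_inj.
rewrite -(subrK (quotient_repr x) x) -addrA {2}exy.
apply: submodD => //; last exact: quotient_reprP.
by rewrite -opprB; apply: submodN => //; apply: quotient_reprP.
Qed.

Lemma quotient_projK (q : quotient) : quotient_proj (val q) = q.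
Proof. by apply: val_inj; case: q => /= v /eqP. Qed.

Definition quotient_add (p q : quotient) := quotient_proj (val p + val q).
Definition quotient_opp (p : quotient) := quotient_proj (- val p).
Definition quotient_scale a (p : quotient) := quotient_proj (a *: val p).

Lemma quotient_projD x y :
  quotient_add (quotient_proj x) (quotient_proj y) = quotient_proj (x + y).
Proof.
apply/quotient_proj_eq; rewrite opprD addrACA.
by apply: submodD => //; apply: quotient_reprP.
Qed.

Lemma quotient_projN x : quotient_opp (quotient_proj x) = quotient_proj (- x).
Proof.
apply/quotient_proj_eq; rewrite opprK addrC -opprB.
by apply: submodN => //; apply: quotient_reprP.
Qed.

Lemma quotient_projZ a x :
  quotient_scale a (quotient_proj x) = quotient_proj (a *: x).
Proof.
apply/quotient_proj_eq; rewrite -scalerBr.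
by apply: submodZ => //; apply: quotient_reprP.
Qed.

Fact quotient_addA : associative quotient_add.
Proof.
move=> p q r; rewrite -(quotient_projK p) -(quotient_projK q) -(quotient_projK r).
by rewrite !quotient_projD addrA.
Qed.
Fact quotient_addC : commutative quotient_add.
Proof. by move=> p q; rewrite /quotient_add addrC. Qed.
Fact quotient_add0 : left_id (quotient_proj 0) quotient_add.
Proof. by move=> p; rewrite -(quotient_projK p) quotient_projD add0r. Qed.
Fact quotient_addN : left_inverse (quotient_proj 0) quotient_opp quotient_add.
Proof.
by move=> p; rewrite -(quotient_projK p) quotient_projN quotient_projD addNr.
Qed.
HB.instance Definition _ := GRing.isZmodule.Build quotient
  quotient_addA quotient_addC quotient_add0 quotient_addN.

Fact quotient_proj_morphD : {morph quotient_proj : x y / x + y}.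
Proof. by move=> x y; rewrite -quotient_projD. Qed.

Fact quotient_scaleA a b p :
  quotient_scale a (quotient_scale b p) = quotient_scale (a * b) p.
Proof. by rewrite -(quotient_projK p) !quotient_projZ scalerA. Qed.
Fact quotient_scale1 : left_id 1 quotient_scale.
Proof. by move=> p; rewrite -(quotient_projK p) quotient_projZ scale1r. Qed.
Fact quotient_scaleDr : right_distributive quotient_scale +%R.
Proof.
move=> a p q; rewrite -(quotient_projK p) -(quotient_projK q).
by rewrite -quotient_proj_morphD !quotient_projZ -quotient_proj_morphD scalerDr.
Qed.
Fact quotient_scaleDl p : {morph quotient_scale^~ p: a b / a + b}.
Proof.
by move=> a b; rewrite -(quotient_projK p) !quotient_projZ -quotient_proj_morphD scalerDl.
Qed.
HB.instance Definition _ := GRing.Zmodule_isLmodule.Build R quotient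
  quotient_scaleA quotient_scale1 quotient_scaleDr quotient_scaleDl.

Fact quotient_proj_linear : linear quotient_proj.
Proof. by move=> a x y; rewrite quotient_proj_morphD -quotient_projZ. Qed.

Definition quotient_lmod : lmodType R := quotient.

End QuotientObject.

Lemma exists_quotient (R : pzRingType) (V : lmodType R) (U : set V) :
  submod U -> exists (W : lmodType R) (p : {linear V -> W}),
    (forall w, exists x, p x = w) /\ forall x, p x = 0 <-> U x.
Proof.
move=> sU; exists (quotient_lmod sU).
have [p pE] := exists_linear (quotient_proj_linear sU); exists p; split=> [w|x].
  by exists (val w); rewrite pE quotient_projK.
by rewrite -(linear0 p) !pE quotient_proj_eq // subr0.
Qed.

(** * Partial linear maps and the Baer criterion *)

Section Graphs.
Variables (R : pzRingType) (N E : lmodType R).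

(* Partial linear maps from [N] to [E], represented by their graphs. *)
Definition linear_graph (G : set (N * E)) : Prop :=
  submod G /\ forall e, G (0, e) -> e = 0.

Lemma linear_graph_inj (G : set (N * E)) n e e' :
  linear_graph G -> G (n, e) -> G (n, e') -> e = e'.
Proof.
move=> [sG G0] Ge Ge'; apply/eqP; rewrite -subr_eq0; apply/eqP/G0.
by rewrite -(subrr n); apply: (submodB sG Ge Ge').
Qed.

Lemma submod_dom (G : set (N * E)) :
  submod G -> submod [set n | exists e, G (n, e)].
Proof.
move=> [G0 GD]; split; first by exists 0.
by move=> a x y [e Ge] [e' Ge']; exists (a *: e + e'); apply: (GD a _ _ Ge Ge').
Qed.

Lemma linear_graph_total (G : set (N * E)) : linear_graph G ->
  (forall n, exists e, G (n, e)) -> exists g : {linear N -> E}, forall n, G (n, g n).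
Proof.
move=> lG /choice[f Gf]; have [_ GD] := lG.1.
have [|g gE] := @exists_linear _ _ _ f; last by exists g => n; rewrite gE.
move=> a x y; apply: (linear_graph_inj lG (Gf _)).
exact: (GD a _ _ (Gf x) (Gf y)).
Qed.

(** The hypothesis says that [e] agrees with every value that [G] already prescribes on multiples of
    [n]; this keeps the enlarged graph single-valued. *)
Lemma linear_graph_extend (G : set (N * E)) n e : linear_graph G ->
  (forall a e', G (a *: n, e') -> e' = a *: e) ->
  linear_graph (sumset G (cyclic ((n, e) : N * E))).
Proof.
move=> [sG G0] ne; split; first by apply: submod_sumset => //; apply: submod_cyclic.
move=> e0 [[x y] [_ [Gxy [a ->] [xE ->]]]].
have xan : x = - a *: n by apply/eqP; rewrite scaleNr -addr_eq0 -xE.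
rewrite (ne (- a) y); last by rewrite -xan.
by rewrite scaleNr addNr.
Qed.

Lemma injective_graph (G : set (N * E)) : injective_module E ->
  linear_graph G -> exists g : {linear N -> E}, forall n e, G (n, e) -> g n = e.
Proof.
move=> injE lG; have [W [i [i_inj iP]]] := exists_submodule lG.1.
have Gi w : G ((i w).1, (i w).2) by rewrite -surjective_pairing; apply/iP; exists w.
have [|i1 i1E] := @exists_linear _ W N (fun w => (i w).1).
  by move=> a x y; rewrite linearP.
have [|i2 i2E] := @exists_linear _ W E (fun w => (i w).2).
  by move=> a x y; rewrite linearP.
have [|g gE] := injE _ _ i1 i2.
  move=> x y; rewrite !i1E => exy; apply: i_inj.
  rewrite [i x]surjective_pairing [i y]surjective_pairing exy; congr (_, _).
  by apply: (linear_graph_inj lG (Gi x)); rewrite exy.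
by exists g => n e /iP[w wE]; have := gE w; rewrite i1E i2E wE.
Qed.

Lemma submod_linear_graph (f : {linear N -> E}) (U : set N) :
  submod U -> linear_graph [set p | U p.1 /\ p.2 = f p.1].
Proof.
move=> [U0 UD]; split; last by move=> e [_ /= ->]; rewrite linear0.
split=> [|a [x y] [x' y'] /= [Ux ->] [Ux' ->]]; first by rewrite /= linear0.
by rewrite linearP; split=> //; apply: UD.
Qed.

End Graphs.

Definition partial_linear (A : pzRingType) (V : lmodType A) (L : set A^o)
    (g : A^o -> V) : Prop :=
  forall c a b, L a -> L b -> g (c *: a + b) = c *: g a + g b.

Lemma partial_linear0 (A : pzRingType) (V : lmodType A) (L : set A^o)
    (g : A^o -> V) : submod L -> partial_linear L g -> g 0 = 0.
Proof.
move=> [L0 _] lg; have := lg (-1) 0 0 L0 L0.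
by rewrite scaleN1r oppr0 addr0 scaleN1r addNr.
Qed.

(** Baer's condition for a subset [U] of an ambient module, so that submodules can be called
    injective, compared and added without being turned into types. The map [g] is a total function
    that is linear only on the left ideal [L]. *)
Definition baer (A : pzRingType) (V : lmodType A) (U : set V) : Prop :=
  forall (L : set A^o) (g : A^o -> V), submod L -> (forall a, L a -> U (g a)) ->
    partial_linear L g ->
    exists2 u, U u & forall a : A, L a -> g a = a *: u.

Section Baer.
Variable A : pzRingType.

(** Baer's argument, with the values kept in [U]. If a maximal extension [H] were undefined at [n],
    the left ideal of scalars sending [n] into its domain would carry a map to [U]; the element [u]
    given by Baer's condition is then an admissible value at [n]. *)
Lemma baer_extension (N E : lmodType A) (U : set E) (G : set (N * E)) :
  submod U -> baer U -> linear_graph G -> (forall n e, G (n, e) -> U e) ->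
  exists2 g : {linear N -> E}, forall n, U (g n) & forall n e, G (n, e) -> g n = e.
Proof.
move=> sU bU lG GU.
pose P (H : set (N * E)) := (forall e, H (0, e) -> e = 0) /\ forall n e, H (n, e) -> U e.
have [|C [G0 CG0] CP _|H [sH GH [H0 HU] maxH]] := @submod_zorn _ _ P _ lG.1.
- by split=> //; case: lG.
- by split=> [e [K /CP[_ _ [K0 _]]]|n e [K /CP[_ _ [_ KU]]]]; [apply: K0|apply: KU].
have lH : linear_graph H by [].
have [g gH] : exists g : {linear N -> E}, forall n, H (n, g n).
  apply: linear_graph_total => // n.
  pose L := [set a : A^o | exists e, H ((a : A) *: n, e)].
  have /choice[g gP] : forall a : A^o, exists e, L a -> H ((a : A) *: n, e).
    by move=> a; have [[e He]|nL] := pselect (L a); [exists e|exists 0].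
  have [|||u Uu gu] := bU L g.
  + split; first by exists 0; rewrite scale0r; apply: submod0 sH.
    move=> a x y [e He] [e' He']; exists (a *: e + e').
    by rewrite scalerDl -scalerA; apply: (sH.2 a _ _ He He').
  + by move=> a /gP /HU.
  + move=> c a b La Lb; apply: (linear_graph_inj lH (gP _ _)).
      have [e He] := La; have [e' He'] := Lb; exists (c *: e + e').
      by rewrite scalerDl -scalerA; apply: (sH.2 c _ _ He He').
    by rewrite scalerDl -scalerA; apply: (sH.2 c _ _ (gP _ La) (gP _ Lb)).
  have nuH : forall a e', H (a *: n, e') -> e' = a *: u.
    move=> a e' Hae'; have La : L a by exists e'.
    by rewrite -gu //; apply: (linear_graph_inj lH Hae'); apply: gP.
  have [sH' H'0] := linear_graph_extend lH nuH.
  exists u; apply: (maxH _ sH'); last by apply: sumset_r => //; apply: cyclicP.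
    by move=> p Hp; apply: sumset_l => //; apply: submod_cyclic.
  split=> // m e [[x y] [_ [Hxy [a ->] [_ ->]]]].
  by apply: submodD => //; [apply: HU Hxy|apply: submodZ].
exists g => [n|n e Gne]; first exact: HU (gH n).
by apply: (linear_graph_inj lH (gH n)); apply: GH.
Qed.

Lemma baer_injective (E : lmodType A) : baer [set: E] -> injective_module E.
Proof.
move=> bE M N i f i_inj.
pose G := [set p : N * E | exists m, p = (i m, f m)].
have lG : linear_graph G.
  split; last first.
    by move=> e [m [/esym im0 ->]]; rewrite (i_inj m 0) ?linear0 // im0 linear0.
  split; first by exists 0; rewrite !linear0.
  by move=> a _ _ [m ->] [m' ->]; exists (a *: m + m'); rewrite !linearP.
have [//|//|g _ gG] := baer_extension _ bE lG.
by exists g => x; apply: gG; exists x.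
Qed.

Lemma retract_baer (E : lmodType A) (U : set E) (h : {linear E -> E}) :
  injective_module E -> (forall x, U (h x)) -> (forall x, U x -> h x = x) ->
  baer U.
Proof.
move=> injE hU hid L g sL gU lg.
have g0 := partial_linear0 sL lg.
pose G := [set p : A^o * E | L p.1 /\ p.2 = g p.1].
have lG : linear_graph G.
  split; last first.
    by move=> e [_ /= ->].
  split=> [|c [x y] [x' y'] [/= Lx ->] [/= Lx' ->]].
    by split; [apply: submod0|rewrite /= g0].
  by split; [apply: (sL.2 c)|rewrite /= lg].
have [k kG] := injective_graph injE lG.
exists (h (k 1)) => // a La.
by rewrite -linearZ -linearZ /= [_ *: _]mulr1 (kG _ (g a)) // hid //; apply: gU.
Qed.

Lemma baer_retract (E : lmodType A) (U : set E) : submod U -> baer U ->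
  exists2 h : {linear E -> E}, forall x, U (h x) & forall x, U x -> h x = x.
Proof.
move=> sU bU.
have [|h hU hG] := baer_extension sU bU (submod_linear_graph idfun sU).
- by move=> n e [/= Un ->].
by exists h => // x Ux; apply: hG.
Qed.

Lemma baer_image (E W : lmodType A) (U : set E) (i : {linear W -> E}) :
  injective i -> (forall x, U x <-> exists w, i w = x) -> baer U ->
  injective_module W.
Proof.
move=> i_inj iP bU; apply: baer_injective => L g sL _ lg.
have [||u Uu gu] := bU L (i \o g) sL.
- by move=> a La /=; apply/iP; exists (g a).
- by move=> c a b La Lb /=; rewrite lg // linearP.
have [w wu] := (iP u).1 Uu.
exists w => // a La; apply: i_inj; rewrite linearZ wu; exact: gu.
Qed.

Lemma baer_sumset (E : lmodType A) (U W : set E) : submod U -> submod W ->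
  (forall x, U x -> W x -> x = 0) -> baer U -> baer W -> baer (sumset U W).
Proof.
move=> sU sW UW0 bU bW L g sL gUW lg.
have uniq u w u' w' : U u -> W w -> U u' -> W w' -> u + w = u' + w' ->
    u = u' /\ w = w'.
  move=> Uu Ww Uu' Ww' e.
  have e' : u - u' = w' - w.
    by apply/eqP; rewrite subr_eq addrAC eq_sym subr_eq addrC e addrC.
  have u0 : u - u' = 0 by apply: UW0; [apply: submodB|rewrite e'; apply: submodB].
  split; first by apply/eqP; rewrite -subr_eq0 u0.
  by apply/eqP; rewrite eq_sym -subr_eq0 -e' u0.
have /choice[h hP] : forall a, exists p : E * E, L a ->
    [/\ U p.1, W p.2 & g a = p.1 + p.2].
  move=> a; have [La|nLa] := pselect (L a); last by exists 0.
  by have [u [w [Uu Ww gE]]] := gUW a La; exists (u, w).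
have hD c a b : L a -> L b -> (h (c *: a + b)).1 = c *: (h a).1 + (h b).1 /\
    (h (c *: a + b)).2 = c *: (h a).2 + (h b).2.
  move=> La Lb; have [Ua Wa ga] := hP a La; have [Ub Wb gb] := hP b Lb.
  have [Uab Wab gab] := hP _ (sL.2 c a b La Lb).
  apply: uniq => //; first exact: sU.2.
    exact: sW.2.
  by rewrite -gab lg // ga gb scalerDr addrACA.
have [||u Uu gu] := bU L (fun a => (h a).1) sL.
- by move=> a /hP[].
- by move=> c a b La Lb; have [] := hD c a b La Lb.
have [||w Ww gw] := bW L (fun a => (h a).2) sL.
- by move=> a /hP[].
- by move=> c a b La Lb; have [] := hD c a b La Lb.
exists (u + w) => [|a La]; first by exists u, w.
by have [_ _ ->] := hP a La; rewrite gu // gw // scalerDr.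
Qed.

Definition essential (V : lmodType A) (X U : set V) : Prop :=
  forall x, U x -> x != 0 -> exists a, X (a *: x) /\ a *: x != 0.

Lemma essential_trans (V : lmodType A) (X Y U : set V) :
  essential X Y -> essential Y U -> essential X U.
Proof.
move=> XY YU x Ux x0; have [a [Yax ax0]] := YU x Ux x0.
have [b [Xbax bax0]] := XY _ Yax ax0.
by exists (b * a); rewrite -scalerA.
Qed.

(* [D] is a maximal essential extension of [X] inside [E]; a complement [C] of
   [D] in [E] then makes [E / C] an essential extension of [D], hence [D] is a
   direct summand. *)
Lemma exists_hull (E : lmodType A) (X : set E) : injective_module E -> submod X ->
  exists D, [/\ submod D, X `<=` D, essential X D & baer D].
Proof.
move=> injE sX.
have [|C [D0 CD0] CP _|D [sD XD eD maxD]] := @submod_zorn _ _ (essential X) X sX.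
- by move=> x Xx x0; exists 1; rewrite scale1r.
- by move=> x [U CU Ux]; have [_ _] := CP U CU; apply.
exists D; split=> //.
pose P (C : set E) := forall x, C x -> D x -> x = 0.
have [|F [D0 FD0] FP _|C [sC _ CD maxC]] := @submod_zorn _ _ P _ (@submod_set0 _ E).
- by move=> x.
- by move=> x [U FU Ux]; have [_ _] := FP U FU; apply.
(* The graph of the projection of [D + C] onto [D] along [C]. Its extension [h] to [E] fixes [D] and
   kills [C], so the image of [h] stands for the quotient [E / C]. *)
pose G := [set p : E * E | D p.2 /\ C (p.1 - p.2)].
have lG : linear_graph G.
  split; last first.
    move=> e [/= De]; rewrite sub0r => Ce; apply: CD => //.
    by rewrite -[e]opprK; apply: submodN.
  split; first by split=> /=; rewrite ?subrr; apply: submod0.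
  move=> a [x y] [x' y'] [/= Dy Cxy] [/= Dy' Cxy']; split=> /=; first exact: sD.2.
  by rewrite opprD addrACA -scalerBr; apply: sC.2.
have [h hG] := injective_graph injE lG.
have hD x : D x -> h x = x.
  by move=> Dx; apply: hG; split=> //=; rewrite subrr; apply: submod0.
have hC x : C x -> h x = 0.
  by move=> Cx; apply: hG; split=> /=; [apply: submod0 sD|rewrite subr0].
have sI := submod_im h (@submod_setT _ E).
apply: (@retract_baer _ _ h injE) => // x.
apply: (maxD _ sI); last by exists x.
  by move=> y Dy; exists y => //; rewrite hD.
apply: (essential_trans eD) => _ [e _ ->] he0.
have nCe : ~ C e by move=> /hC he; rewrite he eqxx in he0.
(* As [e] lies outside the maximal [C], the sum of [C] and [A e] meets [D] in some nonzero [y]. Now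
   [h] fixes [y] and kills its component in [C], which leaves a multiple of [h e]. *)
have [y [Cy Dy y0]] : exists y, [/\ sumset C (cyclic e) y, D y & y <> 0].
  apply: contrapT => nex; apply: nCe; apply: (maxC (sumset C (cyclic e))).
  - by apply: submod_sumset => //; apply: submod_cyclic.
  - by move=> y Cy; apply: sumset_l => //; apply: submod_cyclic.
  - by move=> y Cy Dy; apply: contrapT => y0; apply: nex; exists y.
  - by apply: sumset_r => //; apply: cyclicP.
have [c [_ [Cc [a ->] yE]]] := Cy.
have ha : a *: h e = y by rewrite -[RHS](hD _ Dy) yE linearD linearZ (hC c) // add0r.
by exists a; rewrite ha; split=> //; apply/eqP.
Qed.

End Baer.

(** * Free modules and divisible groups *)

Section FreeModules.
Variable R : pzRingType.

(** A basis [d] is recorded with its coordinate forms [c]: they make linear extension a formula and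
    are pulled back to a dual basis of any projective module. *)
Definition free_basis (T : eqType) (F : lmodType R) (d : T -> F)
    (c : T -> {linear F -> R^o}) : Prop :=
  (forall f, exists s : seq T, [/\ uniq s, forall t, t \notin s -> c t f = 0
      & f = \sum_(t <- s) (c t f : R) *: d t]) /\
  forall t t', c t (d t') = (t == t')%:R.

Lemma exists_free (T : eqType) : exists (F : lmodType R) (d : T -> F)
  (c : T -> {linear F -> R^o}), free_basis d c.
Proof.
pose U := [set f : T -> R^o | exists s : seq T, forall t, t \notin s -> f t = 0].
have sU : submod U.
  split; first by exists nil.
  move=> a f g [s sf] [s' sg]; exists (s ++ s') => t.
  rewrite mem_cat negb_or => /andP[ts ts'].
  by rewrite !fctE sf // sg // scaler0 addr0.
have [F [i [i_inj iP]]] := exists_submodule sU.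
have /choice[d dP] : forall t', exists w, i w = fun t => ((t == t')%:R : R^o).
  move=> t'; apply/iP; exists [:: t'] => t.
  by rewrite inE => /negPf ->.
have /choice[c cP] : forall t, exists g : {linear F -> R^o}, forall f, g f = i f t.
  by move=> t; apply: exists_linear => a f g; rewrite linearP.
exists F, d, c; split=> [f|t t']; last by rewrite cP dP.
have [s sP] := (iP (i f)).2 (ex_intro _ f erefl).
exists (undup s); split; first exact: undup_uniq.
  by move=> t; rewrite mem_undup cP => /sP.
apply: i_inj; apply/funext => t; rewrite linear_sum fct_sumE.
have [ts|ts] := boolP (t \in s); last first.
  rewrite sP // big_seq big1 // => t'; rewrite mem_undup => t's.
  rewrite linearZ /= fctE dP cP; case: eqP => [tt'|_]; last by rewrite scaler0.
  by rewrite tt' t's in ts.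
rewrite (bigD1_seq t) ?mem_undup ?undup_uniq //= big1 ?addr0 => [|t' /negPf tt'].
  by rewrite linearZ /= fctE dP cP eqxx [_ *: _]mulr1.
by rewrite linearZ /= fctE dP eq_sym tt' scaler0.
Qed.

Lemma free_coord_eq (T : eqType) (F : lmodType R) (d : T -> F)
    (c : T -> {linear F -> R^o}) (f g : F) :
  free_basis d c -> (forall t, c t f = c t g) -> f = g.
Proof.
move=> [fP _] fg; apply/eqP; rewrite -subr_eq0; apply/eqP.
have [s [_ _ ->]] := fP (f - g); rewrite big1 // => t _.
by rewrite linearB fg subrr scale0r.
Qed.

Lemma free_sum_widen (T : eqType) (F : lmodType R) (c : T -> {linear F -> R^o})
    (V : lmodType R) (v : T -> V) (f : F) (s s' : seq T) :
  uniq s -> uniq s' -> (forall t, t \notin s -> c t f = 0) -> {subset s <= s'} ->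
  \sum_(t <- s) (c t f : R) *: v t = \sum_(t <- s') (c t f : R) *: v t.
Proof.
move=> us us' fs ss'; rewrite [RHS](bigID (fun t => t \in s)) /=.
rewrite [X in _ = _ + X]big1 ?addr0 => [|t /fs ->]; last by rewrite scale0r.
rewrite -[RHS]big_filter; apply: perm_big; apply: uniq_perm => //.
  exact: filter_uniq.
move=> t; rewrite mem_filter; case: (boolP (t \in s)) => //= ts.
by rewrite ss'.
Qed.

Lemma free_lift (T : eqType) (F : lmodType R) (d : T -> F)
    (c : T -> {linear F -> R^o}) (V : lmodType R) (v : T -> V) :
  free_basis d c -> exists L : {linear F -> V}, forall t, L (d t) = v t.
Proof.
move=> fb; have [/choice[s sP] cd] := fb.
have LE f s' : uniq s' -> {subset s f <= s'} ->
    \sum_(t <- s f) (c t f : R) *: v t = \sum_(t <- s') (c t f : R) *: v t.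
  by move=> us' ss'; have [us s0 _] := sP f; apply: free_sum_widen.
have [|L LP] := @exists_linear _ _ _ (fun f => \sum_(t <- s f) (c t f : R) *: v t).
  move=> a f g; pose s' := undup (s (a *: f + g) ++ s f ++ s g).
  have us' : uniq s' by apply: undup_uniq.
  rewrite !(LE _ s') //; try by move=> t ts; rewrite mem_undup !mem_cat ts ?orbT.
  rewrite scaler_sumr -big_split; apply: eq_bigr => t _ /=.
  by rewrite linearP scalerDl scalerA.
exists L => t; rewrite LP (LE _ (undup (t :: s (d t)))) ?undup_uniq //; last first.
  by move=> t' ts; rewrite mem_undup inE ts orbT.
rewrite (bigD1_seq t) ?mem_undup ?mem_head ?undup_uniq //= big1 ?addr0.
  by rewrite cd eqxx scale1r.
by move=> t' /negPf tt'; rewrite cd tt' scale0r.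
Qed.

Lemma free_projective (T : eqType) (F : lmodType R) (d : T -> F)
    (c : T -> {linear F -> R^o}) : free_basis d c -> projective_module F.
Proof.
move=> fb M N p f p_surj; have /choice[m mP] := fun t => p_surj (f (d t)).
have [g gd] := free_lift m fb; exists g => x.
have [s [_ _ xE]] := fb.1 x; rewrite [in LHS]xE [in RHS]xE !linear_sum.
by apply: eq_bigr => t _; rewrite !linearZ gd mP.
Qed.

Lemma free_lift_onto (T : eqType) (F : lmodType R) (d : T -> F)
    (c : T -> {linear F -> R^o}) (V : lmodType R) (L : {linear F -> V}) (U : set V) :
  submod U -> (forall t, U (L (d t))) -> free_basis d c -> forall f, U (L f).
Proof.
move=> sU Ud fb f; have [s [_ _ fE]] := fb.1 f; rewrite fE linear_sum.
by apply: submod_sum => // t _; rewrite linearZ; apply: submodZ.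
Qed.

(** A cover here is only a surjection from a projective module, without any minimality. *)
Lemma exists_projective_cover (M : lmodType R) :
  exists (P : lmodType R) (p : {linear P -> M}),
    projective_module P /\ forall x, exists y, p y = x.
Proof.
have [F [d [c fb]]] := exists_free M.
have [p pd] := free_lift (fun x : M => x) fb.
by exists F, p; split=> [|x]; [apply: free_projective fb|exists (d x)].
Qed.

(* [s] may be enlarged, so that finitely many [x] can be treated with the same
   [s]. *)
Lemma projective_dual_basis (P : lmodType R) : projective_module P ->
  exists c : P -> {linear P -> R^o}, forall x, exists s : seq P,
    forall s', uniq s' -> {subset s <= s'} -> x = \sum_(t <- s') (c t x : R) *: t.
Proof.
move=> projP; have [F [d [c fb]]] := exists_free P.
have [p pd] := free_lift (fun x : P => x) fb.
have [x|g gP] := projP _ _ p idfun; first by exists (d x).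
have /choice[c' c'E] : forall t, exists h : {linear P -> R^o}, forall x, h x = c t (g x).
  move=> t; apply: (@exists_linear _ _ _ (fun x => c t (g x))) => a x y.
  by rewrite !linearP.
exists c' => x; have [s [us s0 gx]] := fb.1 (g x).
exists s => s' us' ss'; rewrite -[LHS]gP gx linear_sum.
under [RHS]eq_bigr do rewrite c'E.
rewrite -(free_sum_widen id us us' s0 ss').
by apply: eq_bigr => t _; rewrite linearZ /= pd.
Qed.

End FreeModules.

Section EnoughInjectives.

Lemma int_ideal_principal (L : set int^o) : submod L ->
  exists2 d : int, L d & forall a, L a -> exists c : int, a = c * d.
Proof.
move=> sL; have [[d [Ld d0]]|nL] := pselect (exists d : int, L d /\ d != 0); last first.
  exists 0 => [|a La]; first by case: sL.
  exists 0; rewrite mul0r; apply: contrapT => /eqP a0; apply: nL; by exists a.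
pose P (n : nat) := `[< (0 < n)%N /\ L (n%:Z : int^o) >].
have exP : exists n, P n.
  exists `|d|%N; apply/asboolP; split; first by rewrite absz_gt0.
  have [ge|le] := leP 0 d; first by rewrite gez0_abs.
  by rewrite ltz0_abs //; apply: (submodN sL).
case: (ex_minnP exP) => n /asboolP[n0 Ln] nmin; exists n%:Z => // a La.
exists (a %/ n%:Z)%Z; rewrite {1}(divz_eq a n%:Z); apply/eqP.
have nz : n%:Z != 0 by rewrite -lt0n.
rewrite -subr_eq0 addrAC subrr add0r; apply: contraT => r0.
have Lr : L (a %% n%:Z)%Z.
  have -> : (a %% n%:Z)%Z = (- (a %/ n%:Z)%Z) *: (n%:Z : int^o) + a.
    by rewrite [_ *: _]mulNr addrC.
  by apply: sL.2.
have := nmin `|(a %% n%:Z)%Z|%N; rewrite /P.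
have -> : `[< (0 < `|(a %% n%:Z)%Z|)%N /\ L (`|(a %% n%:Z)%Z|%N%:Z : int^o) >].
  apply/asboolP; rewrite absz_gt0; split=> //.
  by rewrite gez0_abs ?modz_ge0.
move=> /(_ isT); rewrite leqNgt -ltz_nat gez0_abs ?modz_ge0 //.
by rewrite ltz_pmod // ltz_nat.
Qed.

Lemma divisible_injective (D : lmodType int) :
  (forall (n : int) (x : D), n != 0 -> exists y, x = n *: y) -> injective_module D.
Proof.
move=> divD; apply: baer_injective => L g sL _ lg.
have [d Ld Ldiv] := int_ideal_principal sL.
have g0 := partial_linear0 sL lg.
have gZ (c : int) : g (c *: (d : int^o)) = c *: g d.
  have := lg c d 0 Ld (submod0 sL).
  by rewrite addr0 g0 addr0.
have [d0|d0] := eqVneq d 0.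
  exists 0 => // a /Ldiv[c]; rewrite d0 mulr0 => ->.
  by rewrite g0 scaler0.
have [e ge] := divD d (g d) d0.
exists e => // a /Ldiv[c ->].
by rewrite -[c * d]/(c *: (d : int^o)) gZ ge scalerA.
Qed.

Lemma fct_mulrz (T : Type) (V : zmodType) (f : T -> V) (a : int) t :
  (f *~ a) t = f t *~ a.
Proof.
have fn n : (f *+ n) t = f t *+ n.
  by elim: n => [|n IHn]; rewrite ?mulr0n // !mulrS -IHn.
by case: a => n; [apply: fn|rewrite -[RHS]/(- (f t *+ n.+1)) -fn].
Qed.

(* [M] is a quotient of a free abelian group [F]; replacing [F] by rational
   functions on its basis gives a divisible group containing [M]. *)
Lemma exists_divisible (M : zmodType) :
  exists (D : lmodType int) (i : {additive M -> D}),
    injective i /\ injective_module D.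
Proof.
have [F [d [c fb]]] := exists_free int M.
have [p pd] := @free_lift _ _ _ _ _ (zmodule M) (fun x => x) fb.
pose Q := zmodule (M -> rat).
have [j jP] : exists j : {linear F -> Q}, forall f, j f = fun t => (c t f : int)%:~R.
  apply: exists_linear => a f g; apply/funext => t.
  rewrite linearP -[a *: c t f]/(a * c t f) intrD intrM.
  rewrite -[RHS]/((a *: ((fun t => (c t f : int)%:~R) : Q)) t + (c t g)%:~R).
  by rewrite scalezrE fct_mulrz -[X in _ = X + _]mulrzr mulrC.
pose K := [set h : Q | exists2 f, p f = 0 & h = j f].
have sK : submod K.
  by apply: submod_im; apply: (@submod_preim _ _ _ p [set 0]); apply: submod_set0.
have [D [q [q_surj qK]]] := exists_quotient sK.
have j_inj : injective j.
  move=> f g; rewrite !jP => fg; apply: (free_coord_eq fb) => t.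
  by apply: (@intr_inj rat); apply: (congr1 (fun h => h t) fg).
have [i iE] : exists i : {additive M -> D}, forall x, i x = q (j (d x)).
  have add_i : zmod_morphism (fun x : M => q (j (d x))).
    move=> x y; rewrite -!linearB; apply/eqP; rewrite -subr_eq0 -!linearB.
    apply/eqP/qK; exists (d (x - y) - (d x - d y)) => //=.
    rewrite !linearB /= !pd -opprD; exact: (subrr (x - y : zmodule M)).
  pose i := GRing.isZmodMorphism.Build M D _ add_i.
  by exists (HB.pack (fun x : M => q (j (d x))) i : {additive M -> D}).
exists D, i; split.
  apply: raddf_inj => x; rewrite iE => /qK[f pf /j_inj dxf].
  by rewrite -(pd x) dxf.
apply: divisible_injective => n x n0; have [h <-] := q_surj x.
exists (q (fun t => h t / n%:~R)); rewrite -linearZ; congr (q _).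
apply/funext => t; transitivity ((h t / n%:~R) *~ n); last first.
  by symmetry; exact: fct_mulrz.
by rewrite -mulrzr mulfVK // intr_eq0.
Qed.

End EnoughInjectives.

(** * Injective envelopes *)

Section Coinduced.
Variables (A : pzRingType) (D : zmodType).

Definition additive_pred : (A -> D) -> bool :=
  fun h => `[< forall a b, h (a + b) = h a + h b >].

Fact additive_pred_zmod_closed : zmod_closed additive_pred.
Proof.
split=> [|h k /asboolP hD /asboolP kD]; apply/asboolP => a b.
  by rewrite addr0.
by rewrite -[LHS]/(h (a + b) - k (a + b)) hD kD opprD addrACA.
Qed.
HB.instance Definition _ := GRing.isZmodClosed.Build (A -> D) additive_pred
  additive_pred_zmod_closed.

(** This is Hom_Z(A, D) with the action (a h)(b) = h(b a). Evaluation at 1 gives the adjunction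
    Hom_A(M, Hom_Z(A, D)) = Hom_Z(M, D), which carries injectivity from Z to [A]. *)
Record coinduced := Coinduced { coinduced_val : A -> D;
  _ : additive_pred coinduced_val }.
HB.instance Definition _ := [isSub for coinduced_val].
HB.instance Definition _ := [Choice of coinduced by <:].
HB.instance Definition _ := [SubChoice_isSubZmodule of coinduced by <:].

Lemma coinduced_valD (h : coinduced) a b : val h (a + b) = val h a + val h b.
Proof. by case: h => h /= /asboolP. Qed.

Definition coinduced_scale (a : A) (h : coinduced) : coinduced.
exists (fun b => val h (b * a)); apply/asboolP => b c.
by rewrite mulrDl coinduced_valD.
Defined.

Fact coinduced_scaleA a b h :
  coinduced_scale a (coinduced_scale b h) = coinduced_scale (a * b) h.
Proof. by apply/val_inj/funext => c /=; rewrite mulrA. Qed.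
Fact coinduced_scale1 : left_id 1 coinduced_scale.
Proof. by move=> h; apply/val_inj/funext => c /=; rewrite mulr1. Qed.
Fact coinduced_scaleDr : right_distributive coinduced_scale +%R.
Proof. by move=> a h k; apply/val_inj/funext. Qed.
Fact coinduced_scaleDl h : {morph coinduced_scale^~ h : a b / a + b}.
Proof.
by move=> a b; apply/val_inj/funext => c; rewrite /= mulrDr coinduced_valD.
Qed.
HB.instance Definition _ := GRing.Zmodule_isLmodule.Build A coinduced
  coinduced_scaleA coinduced_scale1 coinduced_scaleDr coinduced_scaleDl.

Lemma exists_coinduced (M : lmodType A) (h : M -> D) :
  {morph h : x y / x + y} ->
  exists g : {linear M -> coinduced}, forall x a, val (g x) a = h (a *: x).
Proof.
move=> hD.
have ha x : additive_pred (fun a => h (a *: x)).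
  by apply/asboolP => a b; rewrite scalerDl hD.
have [|g gE] := @exists_linear _ M coinduced (fun x => Coinduced (ha x)).
  move=> c x y; apply/val_inj/funext => a /=.
  by rewrite -[RHS]/(h ((a * c) *: x) + h (a *: y)) scalerDr scalerA hD.
by exists g => x a; rewrite gE.
Qed.

End Coinduced.

Lemma additive_int_linear (U : zmodType) (D : lmodType int) (h : U -> D) :
  {morph h : x y / x + y} ->
  exists g : {linear zmodule U -> D}, forall x, g x = h x.
Proof.
move=> hD; apply: exists_linear => n x y; rewrite [LHS]hD; congr (_ + _).
have hB : zmod_morphism h.
  have h0 : h 0 = 0 by apply/(addrI (h 0)); rewrite -hD !addr0.
  move=> u v; rewrite hD; congr (_ + _).
  by apply/(addrI (h v)); rewrite -hD !subrr.
pose h' : {additive U -> D} := HB.pack h (GRing.isZmodMorphism.Build U D h hB).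
rewrite -[LHS]/(h' (x *~ n)) raddfMz -[n in RHS]intz.
by rewrite scaler_int.
Qed.

Section Envelopes.
Variable A : pzRingType.

Lemma coinduced_injective (D : lmodType int) :
  injective_module D -> injective_module (coinduced A D : lmodType A).
Proof.
move=> injD M N i f i_inj.
have [|f' f'E] := @additive_int_linear M D (fun m => val (f m) 1).
  by move=> x y; rewrite linearD.
have [|i' i'E] := @additive_int_linear M (zmodule N) i.
  by move=> x y; rewrite linearD.
have [|g' g'E] := injD _ _ i' f'; first by move=> x y; rewrite !i'E => /i_inj.
have [|g gE] := @exists_coinduced A D N g'; first by move=> x y; rewrite -linearD.
exists g => x; apply/val_inj/funext => a.
rewrite gE -linearZ -i'E g'E f'E linearZ.
by rewrite -[LHS]/(val (f x) (1 * a)) mul1r.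
Qed.

Lemma exists_injective_embedding (M : lmodType A) :
  exists (E : lmodType A) (i : {linear M -> E}), injective_module E /\ injective i.
Proof.
have [D [h [h_inj injD]]] := exists_divisible M.
have [|g gE] := @exists_coinduced A D M h; first by move=> x y; rewrite raddfD.
exists (coinduced A D), g; split; first exact: coinduced_injective.
move=> x y /(congr1 (fun k => val k 1)); rewrite !gE !scale1r; exact: h_inj.
Qed.

Lemma essential_imageP (U V : lmodType A) (f : {linear U -> V}) :
  essential_image f <-> essential [set y | exists x, f x = y] [set: V].
Proof.
split=> [ef x _ x0|ef W sW [w Ww w0]].
  have [|u [/asboolP[a fu] fu0]] := ef _ (submod_pred (submod_cyclic x)).
    by exists x => //; apply/asboolP; apply: cyclicP.
  by exists a; rewrite -fu; split=> //; exists u.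
have [a [[u fu] aw0]] := ef w I w0; exists u; rewrite fu; split=> //.
exact: (submodZ a ((submod_closedP _).1 sW)).
Qed.

Lemma essential_inj (U V W : lmodType A) (f : {linear U -> V})
    (g : {linear V -> W}) :
  essential_image f -> (forall x, g (f x) = 0 -> f x = 0) -> injective g.
Proof.
move=> /essential_imageP ef gf; apply: linear_eq0_inj => v gv.
apply: contrapT => /eqP v0; have [a [[u fu] av0]] := ef v I v0.
by move/eqP: av0; apply; rewrite -fu; apply: gf; rewrite fu linearZ /= gv scaler0.
Qed.

(** Links the hull [D], a subset of [E] that can be added to other submodules of [E], with the
    envelope [W], the module to which a bound on projective dimension applies. *)
Lemma hull_envelope (E X W : lmodType A) (D : set E) (j : {linear W -> E})
    (i : {linear X -> E}) :
  injective i -> injective j -> (forall x, D x <-> exists w, j w = x) ->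
  [set y | exists x, i x = y] `<=` D ->
  essential [set y | exists x, i x = y] D -> baer D ->
  exists2 f : {linear X -> W}, forall x, j (f x) = i x & injective_envelope f.
Proof.
move=> i_inj j_inj jP XD eD bD.
have /choice[f fP] : forall x, exists w, j w = i x.
  by move=> x; apply/jP/XD; exists x.
have [|g gE] := @exists_linear _ _ _ f.
  by move=> a x y; apply: j_inj; rewrite !fP !linearP !fP.
exists g => [x|]; first by rewrite gE.
split; first exact: (baer_image j_inj jP bD).
  by move=> x y gxy; apply: i_inj; rewrite -!fP -!gE gxy.
apply/essential_imageP => w _ w0.
have [||a [[x ix] aw0]] := eD (j w); first by apply/jP; exists w.
  by apply: contra_neq w0 => jw; apply: j_inj; rewrite jw linear0.
exists a; rewrite -linearZ in ix aw0; split.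
  by exists x; apply: j_inj; rewrite gE fP.
by apply: contra_neq aw0 => ->; rewrite linear0.
Qed.

Lemma exists_envelope (X : lmodType A) :
  exists (E : lmodType A) (f : {linear X -> E}), injective_envelope f.
Proof.
have [E [i [injE i_inj]]] := exists_injective_embedding X.
have sX : submod [set y | exists x, i x = y].
  have := submod_im i (@submod_setT _ X); congr submod.
  by apply/seteqP; split=> y [x]; [exists x|exists x].
have [D [sD XD eD bD]] := exists_hull injE sX.
have [W [j [j_inj jP]]] := exists_submodule sD.
by have [f _ ef] := hull_envelope i_inj j_inj jP XD eD bD; exists W, f.
Qed.

(** A map bundled with its endpoints, so that a resolution or coresolution arises by iterating one
    function on the last map built. *)
Record arrow := Arrow { asource : lmodType A; atarget : lmodType A;
  amap : {linear asource -> atarget} }.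

Lemma next_cosyzygy (U V : lmodType A) (d : {linear U -> V}) :
  exists (E : lmodType A) (e : {linear V -> E}),
    [/\ injective_module E, exact_at d e & essential_image e].
Proof.
have sI := submod_im d (@submod_setT _ U).
have [Q [p [p_surj pK]]] := exists_quotient sI.
have [E [f [injE f_inj ef]]] := exists_envelope Q.
exists E, (f \o p); split=> //.
  move=> v /=; split=> [fpv|[u <-]].
    have /pK[u _ ->] : p v = 0 by apply: f_inj; rewrite fpv linear0.
    by exists u.
  by rewrite (_ : p (d u) = 0) ?linear0 //; apply/pK; exists u.
apply/essential_imageP => y _ y0.
have [a [[q fq] ay0]] := (essential_imageP f).1 ef y I y0.
by exists a; split=> //; have [x px] := p_surj q; exists x; rewrite /= px.
Qed.

Lemma exists_min_inj_coresolution (X : lmodType A) : inhabited (min_inj_coresolution X).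
Proof.
have [E [f [injE f_inj ef]]] := exists_envelope X.
have H (d : arrow) : exists n : {V : lmodType A & {linear atarget d -> V}},
    [/\ injective_module (tag n), exact_at (amap d) (tagged n)
      & essential_image (tagged n)].
  have [V [e ?]] := next_cosyzygy (amap d).
  by exists (Tagged (fun V : lmodType A => {linear atarget d -> V}) e).
pose next d := Arrow (tagged (projT1 (cid (H d)))).
pose x n := iter n next (Arrow f).
pose dx n : {linear atarget (x n) -> atarget (x n.+1)} :=
  tagged (projT1 (cid (H (x n)))).
have dxP n : [/\ injective_module (atarget (x n.+1)), exact_at (amap (x n)) (dx n)
    & essential_image (dx n)].
  exact: projT2 (cid (H (x n))).
constructor; exists (fun n => atarget (x n)) f dx => //.
- by case=> [|i]; [exact: injE|have [] := dxP i].
- by have [_ ? _] := dxP 0%N.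
- by move=> i; have [_ ? _] := dxP i.+1.
- by move=> i; have [_ _ ?] := dxP i.
Qed.

End Envelopes.

(** * Left Artinian rings *)

Definition left_dcc (A : pzRingType) : Prop :=
  forall J : nat -> set A^o, (forall i, submod (J i)) ->
    (forall i, J i.+1 `<=` J i) ->
    exists m, forall i, (m <= i)%N -> J m `<=` J i.

Section Span.
Variables (R : pzRingType) (V : lmodType R).

Definition spanned (s : seq V) : set V :=
  foldr (fun x U => sumset (cyclic x) U) [set 0] s.

Lemma submod_spanned s : submod (spanned s).
Proof.
by elim: s => [|x s IHs] /=; [apply: submod_set0|apply/submod_sumset/IHs/submod_cyclic].
Qed.

Lemma spanned_cat s s' x y : spanned s x -> spanned s' y -> spanned (s ++ s') (x + y).
Proof.
elim: s x => [|z s IHs] x /=; first by move=> -> ?; rewrite add0r.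
move=> [u [w [zu sw ->]]] s'y; exists u, (w + y).
by rewrite addrA; split=> //; apply: IHs.
Qed.

Lemma spanned_mem s x : x \in s -> spanned s x.
Proof.
elim: s => //= z s IHs; rewrite inE => /orP[/eqP->|/IHs xs].
  by apply: sumset_l; [apply: submod_spanned|apply: cyclicP].
by apply: sumset_r xs; apply: submod_cyclic.
Qed.

Lemma spanned_sub (U : set V) s : submod U -> (forall x, x \in s -> U x) ->
  spanned s `<=` U.
Proof.
move=> sU; elim: s => [_ x /= ->|x s IHs Us]; first exact: submod0.
apply: sumset_sub => //.
  by apply: cyclic_sub => //; apply: Us; rewrite mem_head.
by apply: IHs => y ys; apply: Us; rewrite inE ys orbT.
Qed.

End Span.

Lemma left_dcc_min (A : pzRingType) (P : set A^o -> Prop) : left_dcc A ->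
  (exists2 U, submod U & P U) ->
  exists U, [/\ submod U, P U &
    forall W, submod W -> P W -> W `<=` U -> U `<=` W].
Proof.
move=> dccA [U0 sU0 PU0]; apply: contrapT => nomin.
pose Q U := submod U /\ P U.
have /choice[next nextP] : forall U, exists W, Q U -> [/\ Q W, W `<=` U & ~ U `<=` W].
  move=> U; have [[sU PU]|nQ] := pselect (Q U); last by exists U.
  apply: contrapT => nW; apply: nomin; exists U; split=> // W sW PW WU.
  by apply: contrapT => nUW; apply: nW; exists W.
pose J i := iter i next U0.
have QJ i : Q (J i) by elim: i => // i /nextP[].
have [|i|m mJ] := dccA J; first by move=> i; have [] := QJ i.
  by have [] := nextP _ (QJ i).
by have [_ _] := nextP _ (QJ m); apply; apply: (mJ m.+1).
Qed.

(** * Chain condition for a module-finite algebra *)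

Section ArtinAlgebra.
Variables (k : comPzRingType) (A : pzRingType) (phi : {rmorphism k -> A}).
Hypothesis artk : artinian k.

Definition k_closed (U : set A) : Prop :=
  U 0 /\ forall c x y, U x -> U y -> U (phi c * x + y).

Fixpoint k_span (s : seq A) : set A :=
  if s is x :: s' then [set z | exists c y, k_span s' y /\ z = phi c * x + y]
  else [set 0].

Lemma k_closed_span s : k_closed (k_span s).
Proof.
elim: s => [|x s [s0 sD]] /=.
  by split=> // c x y /= -> ->; rewrite mulr0 addr0.
split; first by exists 0, 0; rewrite rmorph0 mul0r addr0.
move=> c _ _ [a [u [su ->]]] [b [v [sv ->]]].
exists (c * a + b), (phi c * u + v); split; first exact: sD.
by rewrite rmorphD rmorphM mulrDr mulrDl mulrA addrACA.
Qed.

(** Induction on the generators. The coefficients of [x] occurring in elements of [J i] form a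
    descending chain of ideals [I i] of [k]. Once it is stationary, an element of the earlier term
    can be matched in [J i] with the same coefficient of [x], and the difference lies in [k_span s],
    where the induction hypothesis applies. *)
Lemma k_dcc s (J : nat -> set A) : (forall i, k_closed (J i)) ->
  (forall i, J i.+1 `<=` J i) ->
  exists m, forall i, (m <= i)%N -> J m `&` k_span s `<=` J i.
Proof.
move=> cJ dJ; have dJ' i j : (i <= j)%N -> J j `<=` J i.
  elim: j => [|j IHj]; first by rewrite leqn0 => /eqP->.
  by rewrite leq_eqVlt => /predU1P[->//|/IHj ij]; apply: subset_trans ij.
elim: s => [|x s [m1 IHs]].
  by exists 0%N => i _ z [_ /= ->]; have [] := cJ i.
have [s0 sD] := k_closed_span s.
pose I i : {pred k^o} := fun c : k => `[< exists y, k_span s y /\ J i (phi c * x + y)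
  >].
have [||m2 m2I] := artk (J := I).
- move=> i; have [J0 JD] := cJ i; split.
    by apply/asboolP; exists 0; rewrite rmorph0 mul0r addr0.
  move=> a c d /asboolP[y [sy Jy]] /asboolP[z [sz Jz]]; apply/asboolP.
  exists (phi a * y + z); split; first exact: sD.
  have -> : phi (a *: c + d) * x + (phi a * y + z)
      = phi a * (phi c * x + y) + (phi d * x + z).
    by rewrite rmorphD [phi (a *: c)]rmorphM mulrDl mulrDr mulrA addrACA.
  exact: JD.
- by move=> i c /asboolP[y [sy /dJ Jy]]; apply/asboolP; exists y.
exists (maxn m1 m2) => i; rewrite geq_max => /andP[m1i m2i] z [Jz [c [y [sy zE]]]].
have Ic : c \in I i.
  rewrite m2I //; apply/asboolP; exists y; split=> //.
  by rewrite -zE; apply: dJ' Jz; rewrite leq_maxr.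
have /asboolP[y' [sy' Jy']] := Ic.
have [J0 JD] := cJ i.
have Jyy' : J i (y - y').
  apply: (IHs i m1i); split; last first.
    by rewrite addrC -mulN1r -(rmorph1 phi) -rmorphN; apply: sD.
  have [_ JmD] := cJ m1.
  have -> : y - y' = phi (-1) * (phi c * x + y') + z.
    by rewrite rmorphN rmorph1 mulN1r zE opprD addrACA addNr add0r addrC.
  by apply: JmD; [apply: dJ' Jy'|apply: dJ' Jz; rewrite leq_maxl].
have -> : z = phi 1 * (phi c * x + y') + (y - y').
  by rewrite rmorph1 mul1r zE -addrA; congr (_ + _); rewrite addrC subrK.
exact: JD.
Qed.

End ArtinAlgebra.

Lemma artin_algebra_left_dcc (A : pzRingType) : artin_algebra A -> left_dcc A.
Proof.
move=> [k [phi [artk _ [s sA]]]] J sJ dJ.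
have [|m mJ] := @k_dcc k A phi artk s J _ dJ.
  by move=> i; split=> [|c x y Jx Jy]; [apply: (submod0 (sJ i))|apply: (sJ i).2].
exists m => i mi x Jx; apply: mJ => //; split=> //.
have [c ->] := sA x; move: (s) c => s'; elim: s' => [|y s' IHs] c /=.
  by rewrite big_ord0.
rewrite big_ord_recl /=; exists (c 0%N), (\sum_(i < size s') phi (c i.+1) * s'`_i).
by split=> //; apply: (IHs (fun i => c i.+1)).
Qed.

(** * Jacobson radical, Loewy series and the Hopkins-Levitzki theorem *)

Section Radical.
Variable A : pzRingType.
Hypothesis dccA : left_dcc A.

(** The Jacobson radical as the common annihilator of the simple modules, a form in which it is
    visibly two-sided. *)
Definition radical : set A^o :=
  [set a | forall S : lmodType A, simple_module S ->
             forall x : S, (a : A) *: x = 0].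

Lemma submod_radical : submod radical.
Proof.
split=> [S _ x|c a b ra rb S sS x]; first by rewrite scale0r.
by rewrite scalerDl -scalerA ra // rb // scaler0 addr0.
Qed.

Lemma radicalMr a c : radical a -> radical (a * c).
Proof. by move=> ra S sS x; rewrite -scalerA ra. Qed.

Lemma simple_cyclic (S : lmodType A) (x : S) : simple_module S -> x != 0 ->
  forall y, exists a, y = a *: x.
Proof.
move=> [_ sS] x0 y; have [U0|UT] := sS _ (submod_pred (submod_cyclic x)).
  by rewrite (U0 x) ?eqxx // in x0; apply/asboolP; apply: cyclicP.
by have /asboolP := UT y.
Qed.

(** Elements outside [m] are left invertible modulo [m]. The case [m = A] is allowed, so the
    annihilator of the zero vector needs no separate treatment. *)
Definition maximal_ideal (m : set A^o) : Prop :=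
  submod m /\ forall a : A, ~ m a -> exists b : A, m (1 - b * a).

Lemma annihilator_maximal (S : lmodType A) (x : S) : simple_module S ->
  maximal_ideal [set a | (a : A) *: x = 0].
Proof.
move=> sS; split.
  split=> /= [|c a b ax bx]; first by rewrite scale0r.
  by rewrite scalerDl -scalerA ax bx scaler0 addr0.
move=> a /eqP ax0; have [b xb] := simple_cyclic sS ax0 x.
by exists b => /=; rewrite scalerBl scale1r -scalerA -xb subrr.
Qed.

Fixpoint capset (ms : seq (set A^o)) : set A^o :=
  if ms is m :: ms' then m `&` capset ms' else setT.

Fixpoint all_maximal (ms : seq (set A^o)) : Prop :=
  if ms is m :: ms' then maximal_ideal m /\ all_maximal ms' else True.

Lemma submod_capset ms : all_maximal ms -> submod (capset ms).
Proof.
by elim: ms => [_|m ms IHms [[sm _] /IHms sms]]; [apply: submod_setT|apply: submodI].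
Qed.

(** By the chain condition there is a minimal finite intersection of maximal left ideals.
    Intersecting it with the annihilator of any element of a simple module cannot shrink it, so it
    kills all simple modules. *)
Lemma radical_finite_cap : exists2 ms, all_maximal ms & capset ms `<=` radical.
Proof.
have [|I [sI [ms mms Ims] minI]] :=
    @left_dcc_min A (fun I => exists2 ms, all_maximal ms & I = capset ms) dccA.
  by exists setT; [apply: submod_setT|exists nil].
exists ms => // a msa S sS x.
pose m := [set a : A^o | (a : A) *: x = 0].
have mm : all_maximal (m :: ms) by split=> //; apply: annihilator_maximal.
have := minI _ (submod_capset mm) (ex_intro2 _ _ _ mm erefl).
rewrite Ims => /(_ _ a)[] //.
by move=> b [].
Qed.

(* A module killed by the radical is semisimple, stated relatively: [U / C0] is
   killed by the radical. Writing [capset (m :: ms) y] as [by + (1 - b) y] with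
   [b] in [capset ms] and [1 - b] in [m] reduces to elements with a maximal
   annihilator modulo [C]. *)
Lemma radical_complement (V : lmodType A) (U C0 K : set V) :
  submod U -> submod C0 -> submod K -> C0 `<=` U ->
  (forall a x, radical a -> U x -> C0 ((a : A) *: x)) ->
  exists C, [/\ submod C, C0 `<=` C, C `<=` U, forall x, C x -> K x -> C0 x
    & U `<=` sumset C K].
Proof.
move=> sU sC0 sK C0U rU.
pose P C := C `<=` U /\ forall x, C x -> K x -> C0 x.
have [|F [D0 FD0] FP _|C [sC C0C [CU CK] maxC]] := @submod_zorn _ _ P _ sC0.
- by split.
- split=> [x [D FD Dx]|x [D FD Dx]]; have [_ _ [DU DK]] := FP D FD.
    exact: DU.
  exact: DK.
exists C; split=> //; have [ms mms msr] := radical_finite_cap.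
suff H : forall y, U y -> (forall a, capset ms a -> C ((a : A) *: y)) -> sumset C K y.
  by move=> y Uy; apply: H => // a /msr ra; apply/C0C/rU.
elim: ms mms {msr} => [_ y Uy Cy|m ms IHms [[sm mP] mms] y Uy Cy].
  by apply: sumset_l => //; rewrite -[y]scale1r; apply: Cy.
have sms := submod_capset mms.
have [msm|[a [msa nma]]] : (capset ms `<=` m) \/ exists a, capset ms a /\ ~ m a.
  have [?|nex] := pselect (exists a, capset ms a /\ ~ m a); first by right.
  by left=> a msa; apply: contrapT => nma; apply: nex; exists a.
  by apply: IHms => // a msa; apply: Cy; split=> //; apply: msm.
have [c mca] := mP a nma; pose b := c * a.
have msb : capset ms b by apply: (submodZ c sms).
have sCK := submod_sumset sC sK.
have -> : y = b *: y + (1 - b) *: y by rewrite -scalerDl addrC subrK scale1r.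
apply: (submodD sCK); last first.
  apply: IHms => //; first exact: submodZ.
  move=> d msd; rewrite scalerA; apply: Cy.
  split; last first.
    by rewrite mulrBr mulr1; apply: (submodB sms msd); apply: (submodZ d sms msb).
  exact: (submodZ d sm mca).
have Cmb d : m d -> C (d *: (b *: y)).
  move=> md; rewrite scalerA; apply: Cy; split; last exact: (submodZ d sms msb).
  have -> : d * b = d - d * (1 - b) by rewrite mulrBr mulr1 opprB addrC subrK.
  by apply: (submodB sm md); apply: (submodZ d sm mca).
apply: contrapT => nCK; apply: nCK.
have [CKby|nCKby] := pselect (sumset C K (b *: y)); first by [].
apply: sumset_l => //; apply: (maxC (sumset C (cyclic (b *: y)))).
- by apply: submod_sumset => //; apply: submod_cyclic.
- by move=> x Cx; apply: sumset_l => //; apply: submod_cyclic.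
- split; first by apply: sumset_sub => //; apply: cyclic_sub => //; apply: submodZ.
  move=> _ [x [_ [Cx [d ->] ->]]] Kxd.
  have [md|nmd] := pselect (m d).
    by apply: CK => //; apply: submodD => //; apply: Cmb.
  (* Since [1 - e * d] lies in [m], which sends [b *: y] into [C], multiplying the given element of
     [K] by [e] recovers [b *: y] modulo [C]. *)
  have [e med] := mP d nmd; exfalso; apply: nCKby.
  have -> : b *: y = (- (e *: x) + (1 - e * d) *: (b *: y)) + e *: (x + d *: (b *: y)).
    rewrite scalerBl scale1r scalerDr !scalerA addrACA addNr add0r.
    by rewrite -addrA [- _ + _]addrC -!scalerA; rewrite !scalerA subrr addr0.
  exists (- (e *: x) + (1 - e * d) *: (b *: y)), (e *: (x + d *: (b *: y))).
  split=> //; last exact: submodZ.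
  by apply: submodD; [|apply: submodN => //; apply: submodZ|apply: Cmb].
- by apply: sumset_r => //; apply: cyclicP.
Qed.

(** If [x] were nonzero, its annihilator would lie in a maximal left ideal [m]. This contains
    [1 - j], which kills [x], and [j], which kills the simple module [A / m]; hence it contains
    1. *)
Lemma radical_nakayama (V : lmodType A) (x : V) (j : A) :
  radical j -> x = j *: x -> x = 0.
Proof.
move=> rj xj; apply: contrapT => /eqP x0.
pose N := [set a : A^o | (a : A) *: x = 0].
have sN : submod N.
  split=> [|c a b]; rewrite /N /= ?scale0r // => ax bx.
  by rewrite scalerDl -scalerA ax bx scaler0 addr0.
have [|F [D0 FD0] FP _|m [sm Nm m1 maxm]] :=
    @submod_zorn _ _ (fun m : set A^o => ~ m 1) _ sN.
- by rewrite /N /= scale1r; apply/eqP.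
- by move=> [m Fm m1]; have [_ _] := FP m Fm.
have [Q [p [p_surj pm]]] := exists_quotient sm.
have sQ : simple_module Q.
  split; first by exists (p 1); apply/eqP => /pm.
  move=> U /submod_closedP sU; have [|nU] := pselect (forall x, x \in U -> x = 0).
    by left.
  have [u [Uu u0]] : exists u, u \in U /\ u <> 0.
    apply: contrapT => nex; apply: nU => u Uu.
    by apply: contrapT => u0; apply: nex; exists u.
  right=> y; have [a <-] := p_surj y.
  suff U1 : p 1 \in U.
    rewrite -[a]mulr1 -[a * 1]/(a *: (1 : A^o)) linearZ /=.
    exact: (@submodZ A Q _ a _ sU U1).
  apply: contrapT => nU1; have [b pb] := p_surj u; apply: u0; rewrite -pb; apply/pm.
  apply: (maxm _ (submod_preim p sU)) => //; last by rewrite /= pb.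
  by move=> c /pm pc /=; rewrite pc; apply: (submod0 sU).
apply: m1; rewrite -[1](subrK j) addrC; apply: (submodD sm).
  by apply/pm; rewrite -[j]mulr1 -[j * 1]/(j *: (1 : A^o)) linearZ /=; apply: rj.
by apply: Nm; rewrite /N /= scalerBl scale1r -xj subrr.
Qed.

Fixpoint radical_power (n : nat) : set A^o :=
  if n is n'.+1 then
    [set x | exists s : seq (A * A),
       (forall p, p \in s -> radical_power n' p.1 /\ radical p.2) /\
       x = \sum_(p <- s) p.1 * p.2]
  else setT.

Lemma submod_radical_power n : submod (radical_power n).
Proof.
elim: n => [|n IHn]; first exact: submod_setT.
split; first by exists nil; rewrite big_nil.
move=> a _ _ [s [ss ->]] [s' [ss' ->]].
exists ([seq (a * p.1, p.2) | p <- s] ++ s'); split.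
  move=> p; rewrite mem_cat => /orP[/mapP[q /ss[nq rq] ->]|/ss' //].
  by split=> //=; apply: (submodZ a IHn nq).
rewrite big_cat big_map /=; congr (_ + _); rewrite [LHS]mulr_sumr.
by apply: eq_bigr => p _; rewrite mulrA.
Qed.

Lemma radical_power_decr n : radical_power n.+1 `<=` radical_power n.
Proof.
elim: n => [//|n IHn] _ [s [ss ->]]; exists s; split=> // p /ss[/IHn ? ?].
by split.
Qed.

(** The powers of J become stationary at some B = BJ. If B were nonzero, choose a left ideal L
    minimal with BL nonzero and [x] in L with B[x] nonzero. Then B(J[x]) is nonzero too, so
    minimality gives L inside J[x]; thus [x = j * x] with [j] in J, against Nakayama. *)
Lemma radical_nilpotent : exists n, forall a, radical_power n a -> a = 0.
Proof.
have [n nB] := dccA submod_radical_power radical_power_decr.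
have {}nB := nB n.+1 (leqnSn n); set B := radical_power n in nB.
exists n => b0 Bb0; apply: contrapT => b00.
pose P L := exists b x : A, [/\ B b, L x & b * x <> 0].
have [|L [sL [b [x [Bb Lx bx0]]] minL]] := @left_dcc_min A P dccA.
  by exists setT; [apply: submod_setT|exists b0, 1; rewrite mulr1].
pose L1 := [set y : A^o | exists2 j : A, radical j & y = j * x].
have sL1 : submod L1.
  split; first by exists 0; [apply: (submod0 submod_radical)|rewrite mul0r].
  move=> a _ _ [i ri ->] [j rj ->]; exists (a * i + j).
    exact: (submod_radical.2 a).
  by rewrite mulrDl -mulrA.
have [j rj xj] : L1 x.
  apply: (minL L1) => //.
    have [s [ss bE]] := nB b Bb; apply: contrapT => nP; apply: bx0.
    rewrite bE mulr_suml big_seq big1 // => p /ss[Bp rp].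
    apply: contrapT => px; apply: nP; exists p.1, (p.2 * x); split=> //.
      by exists p.2.
    by rewrite mulrA.
  by move=> _ [j rj ->]; apply: (submodZ j sL).
by apply: bx0; rewrite (@radical_nakayama A^o x j rj xj) mulr0.
Qed.

(** The elements of [V] annihilated by the n-th power of the radical. Each layer of this filtration
    is killed by the radical, hence accessible to [radical_complement]. *)
Fixpoint loewy (V : lmodType A) (n : nat) : set V :=
  if n is n'.+1 then [set x | forall a, radical a -> loewy n' ((a : A) *: x)]
  else [set 0].
Arguments loewy : clear implicits.

Lemma submod_loewy (V : lmodType A) n : submod (loewy V n).
Proof.
elim: n => [|n IHn]; first exact: submod_set0.
split=> [a _|c x y lx ly a ra]; first by rewrite scaler0; apply: submod0.
rewrite scalerDr scalerA; apply: (submodD IHn); last exact: ly.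
by apply: lx; apply: radicalMr.
Qed.

Lemma loewy_incr (V : lmodType A) n : loewy V n `<=` loewy V n.+1.
Proof.
elim: n => [|n IHn] x /=; first by move=> -> a _; rewrite scaler0.
by move=> xn a ra; apply/IHn/xn.
Qed.

Lemma loewy_exhaust : exists n, forall (V : lmodType A) (x : V), loewy V n x.
Proof.
have [n nil_n] := radical_nilpotent.
suff H (V : lmodType A) (x : V) :
    (forall b : A, radical_power n b -> b *: x = 0) -> loewy V n x.
  by exists n => V x; apply: H => b /nil_n ->; rewrite scale0r.
elim: n {nil_n} x => [|n IHn] x H /=; first by rewrite -[x]scale1r; apply: H.
move=> a ra; apply: IHn => b bn; rewrite scalerA; apply: H.
by exists [:: (b, a)]; rewrite big_seq1; split=> // p; rewrite inE => /eqP->.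
Qed.

(** Take [C] minimal above [C0] such that [U] is finitely generated modulo [C]. For [y] in [C]
    outside [C0], let [C'] be maximal in [C] avoiding [y]; the layer being semisimple, [C] is
    contained in [C' + A y]. So [U] is finitely generated modulo [C'] as well, which contradicts
    minimality. *)
Lemma layer_finitely_generated (U C0 : set A^o) : submod U -> submod C0 ->
  C0 `<=` U -> (forall a x, radical a -> U x -> C0 ((a : A) *: x)) ->
  exists2 s : seq A^o, (forall x, x \in s -> U x) & U `<=` sumset C0 (spanned s).
Proof.
move=> sU sC0 C0U rU.
pose P C := [/\ C0 `<=` C, C `<=` U & exists2 s : seq A^o, (forall x, x \in s -> U x)
  & U `<=` sumset C (spanned s)].
have [|C [sC [C0C CU [s sUs Us]] minC]] := @left_dcc_min A P dccA.
  exists U => //; split=> //; exists nil => // x Ux.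
  by apply: sumset_l => //; apply: submod_set0.
exists s => // x /Us[c [d [Cc sd xE]]].
suff CC0 : C `<=` C0 by exists c, d; split=> //; apply: CC0.
move=> y Cy {x c d Cc sd xE}; apply: contrapT => nC0y.
have [|F [D0 FD0] FP _|C' [sC' C0C' [C'C nC'y] maxC']] :=
  @submod_zorn _ _ (fun D : set A^o => D `<=` C /\ ~ D y) _ sC0.
- by split.
- split=> [x [D FD Dx]|[D FD Dy]]; have [_ _ [DC nDy]] := FP D FD => //.
  exact: DC.
have rC a x : radical a -> C x -> C' ((a : A) *: x).
  by move=> ra Cx; apply/C0C'/rU => //; apply: CU.
have [D [sD C'D DC DyC' CDy]] := radical_complement sC sC' (submod_cyclic y) C'C rC.
have DC' : D `<=` C'.
  apply: maxC' => //; split=> // Dy; apply: nC'y.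
  by apply: DyC' => //; apply: cyclicP.
apply: nC'y; apply: (minC C') => //; split=> //.
  by move=> x C'x; apply/CU/C'C.
exists (y :: s) => [x|x /Us[c [d [Cc sd ->]]]].
  by rewrite inE => /orP[/eqP->|/sUs//]; apply: CU.
have [u [v [Du yv ->]]] := CDy c Cc.
exists u, (v + d); rewrite addrA; split=> //; first exact: DC'.
by exists v, d.
Qed.

(** Hopkins-Levitzki: the Loewy series of [A] reaches [A] after finitely many steps and cuts [L]
    into finitely generated layers. *)
Lemma left_noetherian (L : set A^o) : submod L ->
  exists2 s : seq A^o, (forall x, x \in s -> L x) & L `<=` spanned s.
Proof.
move=> sL; have [n nA] := loewy_exhaust.
suff [s sLs Ls] : exists2 s : seq A^o, (forall x, x \in s -> L x)
    & L `&` loewy A^o n `<=` spanned s.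
  by exists s => // x Lx; apply: Ls.
elim: n {nA} => [|n [s sLs Ls]]; first by exists nil => // x [].
have sLn i := submodI sL (submod_loewy A^o i).
have [||s' sL' L's] := layer_finitely_generated (sLn n.+1) (sLn n).
- by move=> x [Lx nx]; split=> //; apply: loewy_incr.
- by move=> a x ra [Lx nx]; split; [apply: submodZ|apply: nx].
exists (s ++ s') => [x|x /L's[u [v [/Ls su s'v ->]]]]; last exact: spanned_cat.
by rewrite mem_cat => /orP[/sLs|/sL'[]].
Qed.

(** Induction on the generators of the ambient module: the possible coefficients of [x] in elements
    of [U] form a finitely generated left ideal, and lifting its generators to [U] leaves a
    remainder in the span of [s]. *)
Lemma submod_finitely_generated (V : lmodType A) (U : set V) (s : seq V) :
  submod U -> U `<=` spanned s ->
  exists2 s' : seq V, (forall x, x \in s' -> U x) & U `<=` spanned s'.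
Proof.
elim: s U => [|x s IHs] U sU Us; first by exists nil.
have ss := submod_spanned s.
have [||s' s'U Us'] := IHs [set y | U y /\ spanned s y]; first exact: submodI.
  by move=> y [].
pose L := [set a : A^o | exists2 v, spanned s v & U ((a : A) *: x + v)].
have [|t tL Lt] := @left_noetherian L.
  split; first by exists 0; [apply: submod0|rewrite scale0r addr0; apply: submod0].
  move=> c a b [v sv Ua] [w sw Ub]; exists (c *: v + w); first exact: ss.2.
  by rewrite scalerDl -scalerA addrACA -scalerDr; apply: sU.2.
have /choice[v vP] : forall a : A^o, exists v, L a -> spanned s v /\ U ((a : A) *: x + v).
  by move=> a; have [[v ? ?]|nL] := pselect (L a); [exists v|exists 0].
pose t' := [seq (a : A) *: x + v a | a <- t].
exists (t' ++ s') => [y|u Uu].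
  rewrite mem_cat => /orP[/mapP[a /tL/vP[_ Ua] -> //]|/s'U[] //].
have [_ [w [[a ->] sw uE]]] := Us u Uu.
have La : L a by exists w; rewrite -?uE.
suff [y [t'y sy]] : exists y, spanned t' y /\ spanned s (y - a *: x).
  have -> : u = y + (u - y) by rewrite addrC subrK.
  apply: spanned_cat => //; apply: Us'; split.
    apply: submodB => //; apply: (spanned_sub sU _ t'y) => z /mapP[b /tL/vP[_ Ub] -> //].
  have -> : u - y = w - (y - a *: x) by rewrite uE opprB addrA [w + _]addrC.
  exact: submodB.
pose I := [set b : A^o | exists y, spanned t' y /\ spanned s (y - (b : A) *: x)].
apply: (@spanned_sub _ _ I t) (Lt a La) => [|b tb].
  split.
    exists 0; rewrite scale0r subrr.
    by split; apply: submod0; apply: submod_spanned.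
  move=> c b d [y [ty sy]] [z [tz sz]]; exists (c *: y + z).
  split; first exact: (submod_spanned t').2.
  rewrite scalerDl -scalerA opprD addrACA -scalerBr; exact: ss.2.
exists ((b : A) *: x + v b); split; last first.
  by rewrite [_ + v b]addrC addrK; have [] := vP b (tL b tb).
by apply: spanned_mem; apply/mapP; exists b.
Qed.

End Radical.

(** * Flat and projective modules *)

Lemma exists_additive (U V : zmodType) (f : U -> V) :
  {morph f : x y / x + y} -> exists g : {additive U -> V}, forall x, g x = f x.
Proof.
move=> fD; have f0 : f 0 = 0 by apply/(addrI (f 0)); rewrite -fD !addr0.
have fB : zmod_morphism f.
  move=> x y; rewrite fD; congr (_ + _).
  by apply/(addrI (f y)); rewrite -fD !subrr.
by exists (HB.pack f (GRing.isZmodMorphism.Build U V f fB) : {additive U -> V}).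
Qed.

Lemma additive_factor (V T G : zmodType) (q : {additive V -> T}) (k : V -> G) :
  (forall w, exists v, q v = w) -> {morph k : x y / x + y} ->
  (forall v, q v = 0 -> k v = 0) ->
  exists h : {additive T -> G}, forall v, h (q v) = k v.
Proof.
move=> /choice[r rP] kD qk; have [k' k'E] := exists_additive kD.
have kE x y : q x = q y -> k x = k y.
  move=> qxy; apply/eqP; rewrite -subr_eq0 -!k'E -raddfB k'E.
  by apply/eqP/qk; rewrite raddfB qxy subrr.
have [|h hE] := @exists_additive _ _ (fun w => k (r w)).
  by move=> x y; rewrite -kD; apply: kE; rewrite raddfD !rP.
by exists h => v; rewrite hE; apply: kE.
Qed.

Lemma linear_factor (R : pzRingType) (V T G : lmodType R) (q : {linear V -> T})
    (k : {linear V -> G}) :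
  (forall w, exists v, q v = w) -> (forall v, q v = 0 -> k v = 0) ->
  exists h : {linear T -> G}, forall v, h (q v) = k v.
Proof.
move=> /choice[r rP] qk.
have kE x y : q x = q y -> k x = k y.
  move=> qxy; apply/eqP; rewrite -subr_eq0 -linearB.
  by apply/eqP/qk; rewrite linearB qxy subrr.
have [|h hE] := @exists_linear _ _ _ (fun w => k (r w)).
  by move=> a x y; rewrite -linearP; apply: kE; rewrite linearP !rP.
by exists h => v; rewrite hE; apply: kE.
Qed.

(** * Tensor products and the equational criterion for flatness *)

Section Tensor.
Variables (A : pzRingType).

Section Balanced.
Variables (M : lmodType A^c) (E : lmodType A) (T : zmodType) (b : M -> E -> T).

Lemma balanced0l x :
  balanced b -> b 0 x = 0.
Proof. by move=> [bl _ _]; apply/(addrI (b 0 x)); rewrite -bl !addr0. Qed.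

Lemma balanced0r m :
  balanced b -> b m 0 = 0.
Proof. by move=> [_ br _]; apply/(addrI (b m 0)); rewrite -br !addr0. Qed.

Lemma balanced_suml (I : Type) (r : seq I) (m : I -> M) x :
  balanced b -> b (\sum_(i <- r) m i) x = \sum_(i <- r) b (m i) x.
Proof.
move=> bb; apply: (big_morph (fun m => b m x)); last exact: balanced0l.
by move=> ? ?; case: bb.
Qed.

Lemma balanced_sumr (I : Type) (r : seq I) m (x : I -> E) :
  balanced b -> b m (\sum_(i <- r) x i) = \sum_(i <- r) b m (x i).
Proof.
move=> bb; apply: (big_morph (b m)); last exact: balanced0r.
by move=> ? ?; case: bb.
Qed.

End Balanced.

(** The projection of [T] onto its quotient by the sums of pure tensors agrees with 0 on pure
    tensors, so the uniqueness clause makes it 0. Viewing [T] as a Z-module makes the quotient of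
    modules available. *)
Lemma tensor_generated (M : lmodType A^c) (E : lmodType A) (T : zmodType)
    (t : M -> E -> T) :
  is_tensor_product t ->
  forall z, exists s : seq (M * E), z = \sum_(p <- s) t p.1 p.2.
Proof.
move=> [[tl tr ta] univ].
have tb : balanced t by [].
pose S := [set z : zmodule T | exists s : seq (M * E), z = \sum_(p <- s) t p.1 p.2].
have SD x y : S x -> S y -> S (x + y).
  by move=> [s ->] [s' ->]; exists (s ++ s'); rewrite big_cat.
have SN x : S x -> S (- x).
  move=> [s ->]; exists [seq (- p.1, p.2) | p <- s].
  rewrite big_map -sumrN; apply: eq_bigr => p _ /=.
  by apply/eqP; rewrite eq_sym -addr_eq0 addrC -tl subrr balanced0l.
have S0 : S 0 by exists nil; rewrite big_nil.
have sS : submod S.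
  split=> // c x y Sx Sy; apply: (SD) => //.
  have Sn n : S (x *+ n) by elim: n => [|n IHn]; rewrite ?mulr0n // mulrS; apply: SD.
  by rewrite scalezrE; case: c => n; [apply: Sn|rewrite NegzE; apply/SN/Sn].
have [Q [q [q_surj qS]]] := exists_quotient sS.
have [q' q'E] : exists q' : {additive T -> Q}, forall x, q' x = q x.
  by apply: exists_additive => x y; rewrite linearD.
have [z' z'E] : exists z' : {additive T -> Q}, forall x, z' x = 0.
  by apply: exists_additive => x y; rewrite addr0.
have H : q' =1 z'.
  apply: (univ Q (fun _ _ => 0) _).2.
    by split=> *; rewrite ?addr0.
  move=> m x; rewrite q'E z'E; apply/qS; exists [:: (m, x)].
  by rewrite big_seq1.
by move=> z; apply/qS; rewrite -q'E H z'E.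
Qed.

Lemma regular_tensor (F : lmodType A) :
  is_tensor_product (fun (m : (A^c)^o) (x : F) => (m : A) *: x).
Proof.
split; first split=> *; rewrite ?scalerDl ?scalerDr //.
  by rewrite scalerA.
move=> G b bb; have [bl br ba] := bb; split=> [|h h' hh' x]; last first.
  by have := hh' 1 x; rewrite scale1r.
have [h hE] := exists_additive (br 1).
exists h => m x; rewrite hE -(ba (m : A) 1 x); congr (b _ x).
by rewrite -[LHS]/((1 : A) * (m : A)) mul1r.
Qed.

Section RightIdealTensor.
Variables (F : lmodType A) (n : nat) (a : 'I_n -> A).

(** The image in F ^ n of S (x) F, where S is the module of vectors [c] with [\sum_i a i * c i = 0]:
    relations that hold in [F] because they already hold in [A]. *)
Definition tensor_relations : set (zmodule ('I_n -> F)) :=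
  [set v | exists s : seq (('I_n -> A) * F),
     (forall p, p \in s -> \sum_i a i * p.1 i = 0) /\
     forall i, v i = \sum_(p <- s) p.1 i *: p.2].

Lemma submod_tensor_relations : submod tensor_relations.
Proof.
split; first by exists nil; split=> // i; rewrite big_nil.
move=> c v w [s [sa vs]] [s' [sa' ws']].
exists ([seq (p.1, p.2 *~ c) | p <- s] ++ s'); split.
  by move=> p; rewrite mem_cat => /orP[/mapP[q /sa qa ->]|/sa'].
move=> i; rewrite big_cat big_map /= -ws'; congr (_ + _).
rewrite scalezrE fct_mulrz vs mulrz_suml; apply: eq_bigr => p _.
by rewrite scalerMzr.
Qed.

(* The tensor product of the right ideal generated by the [a i] with [F] is the
   quotient of [F ^ n] by the trivial relations. *)
Lemma right_ideal_tensor (I : lmodType A^c) (e : {linear I -> (A^c)^o})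
    (T : lmodType int) (q : {linear zmodule ('I_n -> F) -> T}) :
  injective e ->
  (forall x : A, (exists r, e r = x) <-> exists c : 'I_n -> A, x = \sum_i a i * c i) ->
  (forall w, exists v, q v = w) -> (forall v, q v = 0 <-> tensor_relations v) ->
  exists2 t : I -> F -> T, is_tensor_product t &
    forall r c y, (e r : A) = \sum_i a i * c i -> t r y = q (fun i => c i *: y).
Proof.
move=> e_inj eP q_surj qP.
have /choice[c cP] : forall r, exists c : 'I_n -> A, (e r : A) = \sum_i a i * c i.
  by move=> r; apply/eP; exists r.
have /choice[r rP] : forall i, exists r, e r = (a i : A).
  move=> i; apply/eP; exists (fun j => (j == i)%:R).
  by rewrite (bigD1 i) //= eqxx mulr1 big1 ?addr0 // => j /negPf->; rewrite mulr0.
pose t s y := q (fun i => c s i *: y).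
(* Independence of the chosen coefficients: two expressions of [e s] differ by a single trivial
   relation. *)
have tP s d y : (e s : A) = \sum_i a i * d i -> t s y = q (fun i => d i *: y).
  move=> ed; apply/eqP; rewrite -subr_eq0 -linearB; apply/eqP/qP.
  exists [:: (fun i => c s i - d i, y)]; split.
    move=> p; rewrite inE => /eqP-> /=.
    by under eq_bigr do rewrite mulrBr; rewrite sumrB -cP -ed subrr.
  by move=> i; rewrite big_seq1 /= scalerBl.
have esum (I0 : Type) (s0 : seq I0) (d : I0 -> A) (s : I0 -> I) :
    (e (\sum_(j <- s0) (d j : A^c) *: s j) : A) = \sum_(j <- s0) (e (s j) : A) * d j.
  by rewrite linear_sum; apply: eq_bigr => j _; rewrite linearZ.
exists t => //; split.
  split=> [s s' x|s x y|b s x].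
  - rewrite (tP (s + s') (fun i => c s i + c s' i)) /t.
      rewrite -linearD; congr (q _); apply/funext => i.
      by rewrite scalerDl.
    by under eq_bigr do rewrite mulrDr; rewrite big_split -!cP linearD.
  - rewrite /t -linearD; congr (q _); apply/funext => i; exact: scalerDr.
  - rewrite (tP _ (fun i => c s i * b)) /t.
      by congr (q _); apply/funext => i; rewrite scalerA.
    under eq_bigr do rewrite mulrA.
    by rewrite -mulr_suml -cP linearZ.
move=> G b bb; have [bl br ba] := bb; split; last first.
  move=> h h' hh' w; have [v <-] := q_surj w.
  pose single i : zmodule ('I_n -> F) := fun j => ((j == i)%:R : A) *: v i.
  have -> : v = \sum_i single i.
    apply/funext => j; rewrite fct_sumE (bigD1 j) //= big1 ?addr0.
      by rewrite /single eqxx scale1r.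
    by move=> i ij; rewrite /single eq_sym (negPf ij) scale0r.
  rewrite linear_sum !raddf_sum; apply: eq_bigr => i _.
  have qi : q (single i) = t (r i) (v i).
    rewrite (tP _ (fun j => (j == i)%:R)) // rP.
    by rewrite (bigD1 i) //= eqxx mulr1 big1 ?addr0 // => j /negPf->; rewrite mulr0.
  by rewrite qi.
have [|||h hq] := @additive_factor _ T G q (fun v => \sum_i b (r i) (v i)).
- exact: q_surj.
- move=> v w; rewrite -big_split; apply: eq_bigr => i _ /=; exact: br.
- move=> v /qP[s [sa vs]].
  transitivity (\sum_(p <- s) b (\sum_i (p.1 i : A^c) *: r i) p.2).
    under eq_bigr do rewrite vs balanced_sumr //.
    rewrite exchange_big; apply: eq_bigr => p _ /=.
    rewrite balanced_suml //; apply: eq_bigr => i _; by rewrite ba.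
  rewrite big_seq big1 // => p /sa pa.
  rewrite (_ : \sum_i _ = 0) ?balanced0l //; apply: e_inj.
  rewrite esum linear0 -[RHS]pa; apply: eq_bigr => i _.
  by rewrite rP.
- exists h => s x; rewrite hq.
  transitivity (b (\sum_i (c s i : A^c) *: r i) x).
    by rewrite balanced_suml //; apply: eq_bigr => i _; rewrite ba.
  congr (b _ x); apply: e_inj; rewrite esum cP.
  by apply: eq_bigr => i _; rewrite rP.
Qed.

(** The equational criterion. For the right ideal I generated by the [a i], flatness makes I (x) F
    -> A (x) F = F injective. This map sends the class of [f] to [\sum_i a i *: f i], so that class
    is 0. *)
Lemma flat_relation (f : 'I_n -> F) : flat_module F -> \sum_i a i *: f i = 0 ->
  tensor_relations f.
Proof.
move=> flatF af.
pose I := [set x : (A^c)^o | exists c : 'I_n -> A, (x : A) = \sum_i a i * c i].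
have sI : submod I.
  split; first by exists (fun=> 0); rewrite big1 // => i _; rewrite mulr0.
  move=> d x y [c xE] [c' yE]; exists (fun i => c i * d + c' i).
  under eq_bigr do rewrite mulrDr mulrA.
  by rewrite big_split -mulr_suml -xE -yE.
have [R [e [e_inj eI]]] := exists_submodule sI.
have [T [q [q_surj qP]]] := exists_quotient submod_tensor_relations.
have [|t tT tP] := right_ideal_tensor e_inj _ q_surj qP.
  by move=> x; split=> [/eI//|/eI].
have [||h hq] := @additive_factor _ T F q (fun v => \sum_i a i *: v i) q_surj.
- by move=> v w; rewrite -big_split; apply: eq_bigr => i _ /=; exact: scalerDr.
- move=> v /qP[s [sa vs]]; under eq_bigr do rewrite vs scaler_sumr.
  rewrite exchange_big big_seq big1 // => p /sa pa /=.
  by under eq_bigr do rewrite scalerA; rewrite -scaler_suml pa scale0r.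
apply/qP; apply: (flatF _ _ e e_inj _ _ _ _ tT (regular_tensor F) h).
  move=> m x; have [c ec] := (eI (e m)).2 (ex_intro _ m erefl).
  rewrite (tP _ _ _ ec) hq ec scaler_suml; apply: eq_bigr => i _.
  by rewrite scalerA.
by rewrite raddf0 hq.
Qed.

End RightIdealTensor.

(** A dual basis rewrites [z] as a finite sum of tensors [t (w u) u]. The balanced map sending [n],
    [x] to [c u x] acting on [n] extracts [f (w u)] from the image of [z], so every [w u] vanishes
    when that image does. *)
Lemma projective_flat (P : lmodType A) : projective_module P -> flat_module P.
Proof.
move=> /projective_dual_basis[c cP] M N f f_inj T T' t t' tT tT' h hE.
apply: raddf_inj => z hz; have [s zE] := tensor_generated tT z.
have /choice[d dP] := cP.
pose s' := undup (flatten [seq d p.2 | p <- s]).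
have us' : uniq s' by apply: undup_uniq.
pose w u := \sum_(p <- s) (c u p.2 : A^c) *: p.1.
have zw : z = \sum_(u <- s') t (w u) u.
  transitivity (\sum_(p <- s) \sum_(u <- s') t ((c u p.2 : A^c) *: p.1) u).
    rewrite zE big_seq [RHS]big_seq; apply: eq_bigr => p ps.
    rewrite {1}(dP p.2 s' us') ?balanced_sumr //; last 2 first.
    - by case: tT.
    - move=> u up; rewrite mem_undup; apply/flattenP; exists (d p.2) => //.
      by apply/mapP; exists p.
    by apply: eq_bigr => u _; have [[_ _ ->] _] := tT.
  rewrite exchange_big; apply: eq_bigr => u _; rewrite balanced_suml //.
  by case: tT.
have w0 u : w u = 0.
  have [|[g gE] _] := tT'.2 N (fun n x => (c u x : A^c) *: n).
    split=> [n n' x|n x x'|a n x]; rewrite ?scalerDr ?linearD ?scalerDl //.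
    by rewrite (linearZ_LR (c u) a x : _ = a * c u x) scalerA.
  apply: f_inj; rewrite linear0 -[RHS](raddf0 g) -hz zE.
  rewrite [in RHS]raddf_sum [in RHS]raddf_sum.
  by rewrite /w linear_sum; apply: eq_bigr => p _; rewrite hE gE linearZ.
rewrite zw big1 // => u _; rewrite w0 balanced0l //.
by case: tT.
Qed.

End Tensor.

Lemma projective_retract (A : pzRingType) (P F : lmodType A) (p : {linear P -> F})
    (s : {linear F -> P}) :
  projective_module P -> (forall x, p (s x) = x) -> projective_module F.
Proof.
move=> projP ps M N g f g_surj; have [h hP] := projP _ _ g (f \o p) g_surj.
by exists (h \o s) => x /=; rewrite hP /= ps.
Qed.

(** * Flat modules over a left Artinian ring *)

Section FlatProjective.
Variable A : pzRingType.
Hypothesis dccA : left_dcc A.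

(** For a left ideal [L] minimal among those not killing [w], the submodule [L w] is simple. *)
Lemma exists_simple_submodule (V : lmodType A) (w : V) : w != 0 ->
  exists (S : lmodType A) (i : {linear S -> V}),
    [/\ simple_module S, injective i & forall x, cyclic w (i x)].
Proof.
move=> w0.
have [|L [sL [a La aw] minL]] :=
    @left_dcc_min A (fun L => exists2 a : A, L a & a *: w <> 0) dccA.
  by exists setT; [apply: submod_setT|exists 1; rewrite ?scale1r //; apply/eqP].
pose SV := [set x | exists2 a : A, L a & x = a *: w].
have sSV : submod SV.
  split; first by exists 0; [apply: (submod0 sL)|rewrite scale0r].
  move=> c _ _ [b Lb ->] [d Ld ->]; exists (c * b + d); first exact: (sL.2 c).
  by rewrite scalerDl scalerA.
have [S [i [i_inj iS]]] := exists_submodule sSV.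
exists S, i; split=> //; last first.
  by move=> x; have [b _ ->] := (iS (i x)).2 (ex_intro _ x erefl); exists b.
split.
  have [x ix] := (iS (a *: w)).1 (ex_intro2 _ _ a La erefl).
  by exists x; apply/eqP => x0; apply: aw; rewrite -ix x0 linear0.
move=> U /submod_closedP sU.
have [?|nU] := pselect (forall x, x \in U -> x = 0); first by left.
right=> y; pose L' := [set b : A^o | L b /\ exists2 x, x \in U & i x = (b : A) *: w].
have sL' : submod L'.
  split.
    split; first exact: (submod0 sL).
    by exists 0; [apply: (submod0 sU)|rewrite linear0 scale0r].
  move=> c b d [Lb [x Ux ix]] [Ld [x' Ux' ix']]; split; first exact: (sL.2 c).
  exists (c *: x + x'); first exact: (sU.2 c).
  by rewrite linearP ix ix' scalerDl scalerA.
have [b Lb iy] := (iS (i y)).2 (ex_intro _ y erefl).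
have [_ [x Ux ix]] : L' b.
  apply: (minL L') => //; last by move=> d [].
  apply: contrapT => nL'; apply: nU => x Ux; apply: contrapT => x0; apply: nL'.
  have [d Ld ix] := (iS (i x)).2 (ex_intro _ x erefl).
  exists d; first by split=> //; exists x.
  by rewrite -ix => ix0; apply: x0; apply: i_inj; rewrite ix0 linear0.
by rewrite -[y](i_inj x) // ix iy.
Qed.

(* Flatness gives [ker p] and [J M] a trivial intersection, where [J] is the
   radical, and [M / J M] is semisimple. *)
Lemma flat_section_semisimple (M F : lmodType A) (p : {linear M -> F}) :
  flat_module F -> (forall y, exists x, p x = y) ->
  (forall a x, @radical A a -> p x = 0 -> (a : A) *: x = 0) ->
  exists s : {linear F -> M}, forall y, p (s y) = y.
Proof.
move=> flatF p_surj rK.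
pose C0 := [set x | exists s : seq (A * M), (forall q, q \in s -> @radical A q.1)
                      /\ x = \sum_(q <- s) q.1 *: q.2].
have sC0 : submod C0.
  split; first by exists nil; rewrite big_nil.
  move=> c _ _ [s [rs ->]] [s' [rs' ->]]; exists ([seq (c * q.1, q.2) | q <- s] ++ s').
  split; last first.
    rewrite big_cat big_map scaler_sumr; congr (_ + _).
    by apply: eq_bigr => q _; rewrite scalerA.
  move=> q; rewrite mem_cat => /orP[/mapP[q' /rs rq ->]|/rs' //].
  exact: (submodZ c (submod_radical A) rq).
have C0K x : C0 x -> p x = 0 -> x = 0.
  move=> [s [rs xE]] px.
  rewrite big_tnth in xE; set n := size s in xE.
  pose a i := (tnth (in_tuple s) i).1; pose m i := (tnth (in_tuple s) i).2.
  have ra i : radical (a i) by apply/rs/mem_tnth.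
  have [|s' [s'a s'm]] := @flat_relation A F n a (p \o m) flatF.
    rewrite -[RHS]px xE linear_sum; apply: eq_bigr => i _ /=.
    by rewrite linearZ.
  have /choice[z zP] := p_surj.
  (* The relation among the [p (m i)] is trivial, and [z] lifts its terms to [M]. The corrected
     vectors lie in the kernel of [p], which the radical elements [a i] kill; the last sum vanishes
     because its coefficients do. *)
  have -> : x = \sum_i a i *: (m i - \sum_(q <- s') q.1 i *: z q.2)
              + \sum_(q <- s') (\sum_i a i * q.1 i) *: z q.2.
    under eq_bigr do rewrite scalerBr scaler_sumr.
    under [X in _ + X]eq_bigr do rewrite scaler_suml.
    rewrite sumrB -xE exchange_big /=.
    under [X in _ - X]eq_bigr do under eq_bigr do rewrite scalerA.
    by rewrite subrK.
  rewrite big1 => [|i _]; last first.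
    apply: rK => //; rewrite linearB linear_sum [p (m i)]s'm -sumrB big1 // => q _.
    by rewrite linearZ /= zP subrr.
  by rewrite add0r big_seq big1 // => q /s'a ->; rewrite scale0r.
have [|C [sC C0C _ CK UCK]] := radical_complement dccA (@submod_setT _ M) sC0
    (submod_preim p (submod_set0 F)) (fun _ _ => I).
  move=> a x ra _; exists [:: (a, x)]; rewrite big_seq1; split=> // q.
  by rewrite inE => /eqP->.
(* The inverse of [p] restricted to [C]: [C] meets the kernel of [p] only in 0 and together with it
   spans [M]. *)
pose G := [set yx : F * M | C yx.2 /\ p yx.2 = yx.1].
have lG : linear_graph G.
  split; last by move=> e [/= Ce pe]; apply: C0K => //; apply: CK.
  split; first by split; [apply: submod0|rewrite linear0].
  move=> a [y x] [y' x'] [/= Cx px] [/= Cx' px']; split; first exact: (sC.2 a).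
  by rewrite linearP px px'.
have [|g gG] := linear_graph_total lG.
  move=> y; have [x px] := p_surj y; have [c [k [Cc pk xE]]] := UCK x I.
  by exists c; split=> //=; rewrite -px xE linearD (pk : p k = 0) addr0.
by exists g => y; case: (gG y).
Qed.

Lemma loewy_inj (V W : lmodType A) (j : {linear W -> V}) n w :
  injective j -> @loewy A V n (j w) -> @loewy A W n w.
Proof.
move=> j_inj; elim: n w => [|n IHn] w /=; first by rewrite -[0](linear0 j) => /j_inj.
by move=> lw a ra; apply: IHn; rewrite linearZ; apply: lw.
Qed.

(** Induction on the Loewy length of the kernel. Modulo [loewy M n] inside the kernel, what remains
    of the kernel is killed by the radical and the map splits; the preimage [M2] of that splitting
    still covers [F], with kernel inside [loewy M n]. *)
Lemma flat_section (M F : lmodType A) (p : {linear M -> F}) n :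
  flat_module F -> (forall y, exists x, p x = y) ->
  (forall x, p x = 0 -> @loewy A M n x) ->
  exists s : {linear F -> M}, forall y, p (s y) = y.
Proof.
move=> flatF; elim: n M p => [|n IHn] M p p_surj pl.
  apply: flat_section_semisimple => // a x _ /pl /= ->; exact: scaler0.
have sK := submodI (submod_preim p (submod_set0 F)) (submod_loewy M n).
have [Q [q [q_surj qK]]] := exists_quotient sK.
have [p' p'q] : exists p' : {linear Q -> F}, forall x, p' (q x) = p x.
  by apply: linear_factor => // x /qK[].
have [y||s sP] := @flat_section_semisimple _ _ p' flatF.
- by have [x <-] := p_surj y; exists (q x).
- move=> a x' ra; have [x <-] := q_surj x'; rewrite p'q => px.
  by rewrite -linearZ; apply/qK; split; [rewrite /= linearZ /= px scaler0|apply: pl].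
pose M2 := [set x | q x = s (p x)].
have sM2 : submod M2.
  split; first by rewrite /M2 /= !linear0.
  by move=> a x y qx qy; rewrite /M2 /= !linearP qx qy.
have [W [j [j_inj jM2]]] := exists_submodule sM2.
have [||s2 s2P] := IHn W (p \o j).
- move=> y; have [x qx] := q_surj (s y).
  have px : p x = y by rewrite -p'q qx sP.
  have [w jw] : exists w, j w = x by apply/jM2; rewrite /M2 /= px.
  by exists w; rewrite /= jw.
- move=> w /= pw; apply: (loewy_inj j_inj).
  have qw : q (j w) = s (p (j w)) by apply: (jM2 (j w)).2; exists w.
  by rewrite pw linear0 in qw; have [] := (qK _).1 qw.
by exists (j \o s2) => y; apply: s2P.
Qed.

Lemma flat_projective (F : lmodType A) : flat_module F -> projective_module F.
Proof.
move=> flatF; have [P [p [projP p_surj]]] := exists_projective_cover F.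
have [n nA] := loewy_exhaust dccA.
have [s sP] := flat_section flatF p_surj (fun x _ => nA P x).
exact: projective_retract sP.
Qed.

End FlatProjective.

(** * Projective dimension and Ext *)

Arguments res_exact0 {A C X} r v.
Arguments res_exact {A C X} r i v.
Arguments cores_exact0 {A X} m v.
Arguments cores_exact {A X} m i v.
Arguments cores_aug_inj {A X} m x1 x2 _.
Arguments cores_aug_min {A X} m W _ _.
Arguments cores_min {A X} m i W _ _.
Arguments cores_injective {A X} m i M N i f _.

Lemma least_leP (P : nat -> Prop) (n : nat) :
  (least P <= EFin n%:Z)%E <-> exists2 m, (m <= n)%N & P m.
Proof.
rewrite /least; case: pselect => [exP|nex].
  case: ex_minnP => m /asboolP Pm minm; rewrite lee_fin lez_nat.
  split=> [mn|[m' m'n Pm']]; first by exists m.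
  by apply: leq_trans m'n; apply/minm/asboolP.
split=> [|[m _ Pm]]; first by rewrite leye_eq.
by case: nex; exists m; apply/asboolP.
Qed.

Section HomologicalAlgebra.
Variable A : pzRingType.
Implicit Types M N X U V W : lmodType A.

Definition short_exact U V W (i : {linear U -> V}) (p : {linear V -> W}) : Prop :=
  [/\ injective i, forall y, exists x, p x = y & exact_at i p].

Lemma linear_lift_inj U V W (i : {linear U -> V}) (f : {linear W -> V}) :
  injective i -> (forall x, exists u, i u = f x) ->
  exists g : {linear W -> U}, forall x, i (g x) = f x.
Proof.
move=> i_inj /choice[g gP].
have [|g' g'E] := @exists_linear _ _ _ g.
  by move=> a x y; apply: i_inj; rewrite gP !linearP !gP.
by exists g' => x; rewrite g'E.
Qed.

Lemma projective_lift (P U V W : lmodType A) (e : {linear U -> V})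
    (e' : {linear V -> W}) (f : {linear P -> V}) :
  projective_module P -> exact_at e e' -> (forall x, e' (f x) = 0) ->
  exists g : {linear P -> U}, forall x, e (g x) = f x.
Proof.
move=> projP ex f0.
have [K [i [i_inj iK]]] := exists_submodule (submod_preim e' (submod_set0 W)).
have [x|f' f'E] := linear_lift_inj i_inj (f := f); first exact/iK/f0.
have [x|e1 e1E] := linear_lift_inj i_inj (f := e).
  by apply/iK/ex; exists x.
have [k|g gE] := projP _ _ e1 f'.
  have /ex[u eu] : e' (i k) = 0 by apply/iK; exists k.
  by exists u; apply: i_inj; rewrite e1E.
by exists g => x; rewrite -e1E gE f'E.
Qed.

Lemma injective_extend (E U V W : lmodType A) (d : {linear U -> V})
    (d' : {linear V -> W}) (f : {linear V -> E}) :
  injective_module E -> exact_at d d' -> (forall x, f (d x) = 0) ->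
  exists g : {linear W -> E}, forall x, g (d' x) = f x.
Proof.
move=> injE ex f0; pose G := [set p : W * E | exists v, p = (d' v, f v)].
have lG : linear_graph G.
  split; last by move=> e [v [/esym/ex[u <-] ->]].
  split; first by exists 0; rewrite !linear0.
  by move=> a _ _ [v ->] [v' ->]; exists (a *: v + v'); rewrite !linearP.
have [g gG] := injective_graph injE lG.
by exists g => x; apply: gG; exists x.
Qed.

Lemma exists_projective_presentation M :
  exists (K P : lmodType A) (i : {linear K -> P}) (p : {linear P -> M}),
    projective_module P /\ short_exact i p.
Proof.
have [P [p [projP p_surj]]] := exists_projective_cover M.
have [K [i [i_inj iK]]] := exists_submodule (submod_preim p (submod_set0 M)).
by exists K, P, i, p.
Qed.

Lemma exists_injective_copresentation N :
  exists (E C : lmodType A) (j : {linear N -> E}) (q : {linear E -> C}),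
    injective_module E /\ short_exact j q.
Proof.
have [E [j [injE j_inj]]] := exists_injective_embedding N.
have [C [q [q_surj qP]]] := exists_quotient (submod_im j (@submod_setT _ N)).
exists E, C, j, q; split=> //; split=> // v; split=> [/qP[x _ ->]|[u <-]].
  by exists x.
by apply/qP; exists u.
Qed.

Definition lifts M (E C : lmodType A) (q : {linear E -> C}) : Prop :=
  forall f : {linear M -> C}, exists g : {linear M -> E}, forall x, q (g x) = f x.

(* Both sides say that Ext^1(X, N) = 0. *)
Lemma ext1_balance (K P X N E C : lmodType A) (i : {linear K -> P})
    (p : {linear P -> X}) (j : {linear N -> E}) (q : {linear E -> C}) :
  short_exact i p -> short_exact j q -> projective_module P -> injective_module E ->
  (forall f : {linear K -> N}, exists g : {linear P -> N}, forall x, g (i x) = f x)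
  <-> lifts X q.
Proof.
move=> [i_inj p_surj exp] [j_inj q_surj exq] projP injE.
have pi x : p (i x) = 0 by apply/exp; exists x.
have qj x : q (j x) = 0 by apply/exq; exists x.
split=> [H f|H f].
  have [h hP] := projP _ _ q (f \o p) q_surj.
  have [x|k kP] := linear_lift_inj j_inj (f := h \o i).
    by apply/exq; rewrite hP /= pi linear0.
  have [k' k'P] := H k.
  have [y|g gP] := linear_factor p_surj (k := h \- (j \o k')).
    by move=> /exp[x <-] /=; rewrite k'P kP subrr.
  exists g => x; have [y <-] := p_surj x.
  by rewrite gP /= linearB qj subr0 hP.
have [h hP] := injE _ _ i (j \o f) i_inj.
have [y|k kP] := linear_factor p_surj (k := q \o h).
  by move=> /exp[x <-] /=; rewrite hP qj.
have [g gP] := H k.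
have [y|m mP] := linear_lift_inj j_inj (f := h \- (g \o p)).
  by apply/exq; rewrite linearB /= gP kP subrr.
by exists m => x; apply: j_inj; rewrite mP /= hP pi linear0 subr0.
Qed.

(** Bounded projective dimension unfolded one syzygy at a time, the form suited to dimension
    shifting. *)
Fixpoint pd_le (g : nat) M : Prop :=
  if g is g'.+1 then
    exists (K P : lmodType A) (i : {linear K -> P}) (p : {linear P -> M}),
      [/\ projective_module P, short_exact i p & pd_le g' K]
  else projective_module M.

Fixpoint cosyzygy (g : nat) N : Prop :=
  if g is g'.+1 then
    exists (N' E' : lmodType A) (i : {linear N' -> E'}) (q : {linear E' -> N}),
      [/\ injective_module E', short_exact i q & cosyzygy g' N']
  else True.

(* Ext^(g+1)(M, -) is Ext^1(M, -) on g-th cosyzygies. *)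
Lemma pd_le_lifts g M : pd_le g M <->
  forall (N E C : lmodType A) (j : {linear N -> E}) (q : {linear E -> C}),
    injective_module E -> short_exact j q -> cosyzygy g N -> lifts M q.
Proof.
elim: g M => [|g IHg] M; split=> /=.
- by move=> projM N E C j q _ [_ q_surj _] _ f; apply: projM.
- move=> H; have [K [P [i [p [projP sp]]]]] := exists_projective_presentation M.
  have [E [C [j [q [injE sq]]]]] := exists_injective_copresentation K.
  (* The vanishing of Ext^1(M, K) extends the identity of [K] to [P], which splits [p]. *)
  have [h hi] := (ext1_balance sp sq projP injE).2 (H _ _ _ _ _ injE sq I) idfun.
  have [i_inj p_surj exp] := sp.
  have [y|s sP] := linear_factor p_surj (k := idfun \- (i \o h)).
    by move=> /exp[x <-] /=; rewrite hi subrr.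
  apply: (projective_retract (p := p) (s := s)) => // x.
  have [y <-] := p_surj x; rewrite sP /= linearB.
  by rewrite (_ : p (i _) = 0) ?subr0 //; apply/exp; exists (h y).
- move=> [K [P [i [p [projP sp /IHg HK]]]]] N E C j q injE sq.
  move=> [N' [E' [i' [q' [injE' sq' cN']]]]].
  apply/(ext1_balance sp sq projP injE) => f.
  have [f' f'P] := HK _ _ _ _ _ injE' sq' cN' f.
  have [i_inj _ _] := sp; have [g' g'P] := injE' _ _ i f' i_inj.
  by exists (q' \o g') => x /=; rewrite g'P f'P.
- move=> H; have [K [P [i [p [projP sp]]]]] := exists_projective_presentation M.
  exists K, P, i, p; split=> //; apply/IHg => N' E' N i' q' injE' sq' cN' f.
  have [E [C [j [q [injE sq]]]]] := exists_injective_copresentation N.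
  have cN : cosyzygy g.+1 N by exists N', E', i', q'.
  have [h hP] := (ext1_balance sp sq projP injE).2 (H _ _ _ _ _ injE sq cN) f.
  have [_ q'_surj _] := sq'; have [k kP] := projP _ _ q' h q'_surj.
  by exists (k \o i) => x /=; rewrite kP hP.
Qed.

Lemma pd_le_retract g M N (p : {linear M -> N}) (s : {linear N -> M}) :
  (forall x, p (s x) = x) -> pd_le g M -> pd_le g N.
Proof.
move=> ps /pd_le_lifts HM; apply/pd_le_lifts => N' E C j q injE sq cN f.
have [h hP] := HM _ _ _ _ _ injE sq cN (f \o p).
by exists (h \o s) => x /=; rewrite hP /= ps.
Qed.

Lemma resolution_tail (C : lmodType A -> Prop) M (R : resolution C M) :
  exists (K : lmodType A) (i : {linear K -> R 0%N}) (R' : resolution C K),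
    short_exact i (res_aug R) /\
    forall j, (forall x : R j.+1, x = 0) -> forall x : R' j, x = 0.
Proof.
have [K [i [i_inj iK]]] := exists_submodule (submod_preim (res_aug R) (submod_set0 M)).
have ex0 := res_exact0 R.
have [x|d dP] := linear_lift_inj i_inj (f := res_diff R 0).
  by apply/iK/ex0; exists x.
exists K, i; unshelve eexists.
  apply: (@Resolution A C K (fun j => R j.+1) (fun j => res_diff R j.+1) d).
  - by move=> j; apply: res_class.
  - move=> k; have /ex0[x dx] : res_aug R (i k) = 0 by apply/iK; exists k.
    by exists x; apply: i_inj; rewrite dP.
  - move=> v; rewrite -(res_exact R 0 v) -dP; split=> [->|]; first by rewrite linear0.
    by rewrite -[0](linear0 i) => /i_inj.
  - by move=> j; apply: res_exact.
split=> //; split=> //; exact: res_aug_surj.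
Qed.

Lemma resolution_cons (C : lmodType A -> Prop) (K P M : lmodType A)
    (i : {linear K -> P}) (p : {linear P -> M}) (R : resolution C K) (g : nat) :
  C P -> short_exact i p -> (forall j, (g < j)%N -> forall x : R j, x = 0) ->
  exists R' : resolution C M, forall j, (g.+1 < j)%N -> forall x : R' j, x = 0.
Proof.
move=> CP [i_inj p_surj exp] Rg.
pose T j : lmodType A := if j is j'.+1 then R j' else P.
pose d j : {linear T j.+1 -> T j} :=
  match j return {linear T j.+1 -> T j} with
  | 0 => i \o res_aug R
  | j'.+1 => res_diff R j'
  end.
unshelve eexists.
  apply: (@Resolution A C M T d p) => //.
  - by case=> [//|j]; apply: res_class.
  - move=> v; split=> [/exp[k <-]|[u <-]].
      by have [x <-] := res_aug_surj R k; exists x.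
    by apply/exp; exists (res_aug R u).
  - case=> [|j] v; last exact: res_exact.
    rewrite -(res_exact0 R v) /=; split=> [|->]; last by rewrite linear0.
    by rewrite -[0](linear0 i) => /i_inj.
by case=> [//|j] gj; apply: Rg.
Qed.

Lemma exists_zero_module : exists Z : lmodType A, forall x : Z, x = 0.
Proof.
have [Z [z [z_inj zP]]] := exists_submodule (@submod_set0 A A^o).
exists Z => x; apply: z_inj; rewrite linear0.
exact: ((zP (z x)).2 (ex_intro _ x erefl)).
Qed.

Lemma exists_zero_linear (U V : lmodType A) :
  exists f : {linear U -> V}, forall x, f x = 0.
Proof. by apply: (@exists_linear _ U V (fun=> 0)) => a x y; rewrite scaler0 addr0. Qed.

Lemma projective_resolutionP g M :
  (exists R : resolution (@projective_module A) M,
     forall j, (g < j)%N -> forall x : R j, x = 0) <-> pd_le g M.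
Proof.
split.
  elim: g M => [|g IHg] M [R Rg] /=; have [K [i [R' [sR RR']]]] := resolution_tail R.
    have [i_inj p_surj exp] := sR.
    have p_inj : injective (res_aug R).
      apply: linear_eq0_inj => x /(res_exact0 R)[y <-].
      by rewrite (Rg 1%N isT y) linear0.
    have [x|s sP] := linear_lift_inj p_inj (f := idfun).
      by have [y <-] := p_surj x; exists y.
    exact: (projective_retract (res_class R 0) sP).
  exists K, (R 0%N), i, (res_aug R); split=> //; first exact: res_class.
  by apply: IHg; exists R' => j gj; apply: RR'; apply: Rg.
have [Z Z0] := exists_zero_module.
have projZ : projective_module Z.
  move=> N N' p f _; have [h hE] := exists_zero_linear Z N.
  by exists h => x; rewrite hE (Z0 x) !linear0.
elim: g M => [|g IHg] M /= HM; last first.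
  have [K [P [i [p [projP sp /IHg[R Rg]]]]]] := HM.
  exact: resolution_cons sp Rg.
have [h hE] := exists_zero_linear Z M.
pose T j : lmodType A := if j is j'.+1 then Z else M.
pose d j : {linear T j.+1 -> T j} :=
  match j return {linear T j.+1 -> T j} with 0 => h | j'.+1 => idfun end.
unshelve eexists.
  apply: (@Resolution A _ M T d idfun) => //.
  - by case.
  - by move=> x; exists x.
  - move=> v; split=> [/= ->|[u <-] /=]; last by rewrite hE.
    by exists 0; rewrite linear0.
  - case=> [|j] v; rewrite (Z0 v) linear0; split=> // _; exists 0; exact: linear0.
by case.
Qed.

Lemma pdim_leP g M : (pdim M <= EFin g%:Z)%E <-> pd_le g M.
Proof.
rewrite least_leP -projective_resolutionP; split=> [[m mg [R Rm]]|[R Rg]].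
  by exists R => j gj; apply: Rm; apply: leq_ltn_trans gj.
by exists g => //; exists R.
Qed.

Lemma fdim_leP g M : left_dcc A -> (fdim M <= EFin g%:Z)%E <-> pd_le g M.
Proof.
move=> dccA; rewrite least_leP -projective_resolutionP; split=> [[m mg [R Rm]]|[R Rg]].
  have RP j : projective_module (R j).
    by apply: (@flat_projective _ dccA); exact: (@res_class _ _ _ R j).
  exists (Resolution RP (res_aug_surj R) (res_exact0 R) (res_exact R)) => j gj.
  by apply: Rm; apply: leq_ltn_trans gj.
have RF j : flat_module (R j).
  by apply: (@projective_flat _); exact: (@res_class _ _ _ R j).
by exists g => //; exists (Resolution RF (res_aug_surj R) (res_exact0 R) (res_exact R)).
Qed.

End HomologicalAlgebra.

(** * Ext from projective and from injective resolutions *)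

Section Balance.
Variable A : pzRingType.
Variables (Q : nat -> lmodType A) (d : forall j, {linear Q j.+1 -> Q j}).
Variables (J : nat -> lmodType A) (e : forall j, {linear J j -> J j.+1}).
Hypothesis exQ : forall j, exact_at (d j.+1) (d j).
Hypothesis exJ : forall j, exact_at (e j) (e j.+1).
Hypothesis projQ : forall j, projective_module (Q j.+2).
Hypothesis injJ : forall j, injective_module (J j.+2).

(* Cohomology of the double complex Hom(Q, J), taken along the diagonal. *)
Definition hom_acyclic a b : Prop :=
  forall f : {linear Q a.+1 -> J b.+1}, (forall x, e b.+1 (f (d a.+1 x)) = 0) ->
  exists (u : {linear Q a -> J b.+1}) (v : {linear Q a.+1 -> J b}),
    forall x, f x = u (d a x) + e b (v x).

(** One step of the zigzag: neighbouring maps f and g correspond through f d = e g, where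
    projectivity produces g from f and injectivity produces f from g. Both are required from index 2
    on only, since the lower places will hold a zero module and the resolved module. *)
Lemma hom_acyclic_shift a b : hom_acyclic a.+1 b <-> hom_acyclic a b.+1.
Proof.
have dd j x : d j (d j.+1 x) = 0 by apply/(@exQ j); exists x.
have ee j x : e j.+1 (e j x) = 0 by apply/(@exJ j); exists x.
split=> H f f0.
  have [x|g gP] := projective_lift (f := f \o d a.+1) (@projQ a) (@exJ b.+1); first exact: f0.
  have [x|u [v uvP]] := H g; first by rewrite gP /= dd linear0.
  have [x|w wP] := injective_extend (f := f \- (e b.+1 \o u)) (@injJ b) (@exQ a).
    by have := gP x; rewrite uvP linearD ee addr0 /= => <-; rewrite subrr.
  by exists w, u => x; rewrite wP /= subrK.
have [x|g gP] := injective_extend (f := e b.+1 \o f) (@injJ b) (@exQ a.+1); first exact: f0.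
have [x|u [v uvP]] := H g; first by rewrite gP /= ee.
have [x|w wP] := projective_lift (f := f \- (v \o d a.+1)) (@projQ a) (@exJ b).
  by have := gP x; rewrite uvP dd linear0 add0r linearB /= => <-; rewrite subrr.
by exists v, w => x; rewrite wP /= addrC subrK.
Qed.

Lemma hom_acyclic_balance a b : hom_acyclic a b <-> hom_acyclic 0 (a + b).
Proof.
elim: a b => [//|a IHa] b; rewrite hom_acyclic_shift IHa.
by rewrite addnS.
Qed.

End Balance.

(** * Ext of simple modules and dimension shifting *)

Section Ext.
Variable A : pzRingType.

Lemma ext_coresolution (X N : lmodType A) (P : resolution (@projective_module A) X)
    (I : min_inj_coresolution N) i :
  (forall f : {linear P i.+1 -> N}, cocycle f -> coboundary f) <->
  (forall f : {linear X -> I i.+1}, (forall x, cores_diff I i.+1 (f x) = 0) ->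
     exists v : {linear X -> I i}, forall x, f x = cores_diff I i (v x)).
Proof.
have [Z Z0] := exists_zero_module A.
have [zX _] := exists_zero_linear X Z; have [zN _] := exists_zero_linear Z N.
(* Both complexes include the augmentation and start with a zero module, hence are exact throughout.
   With this shift by 2, acyclicity at [(i.+2, 0)] concerns maps from [P i.+1] to [N], and at
   [(0, i.+2)] maps from [X] to [I i.+1]. *)
pose Q j : lmodType A := match j with 0 => Z | 1 => X | j'.+2 => P j' end.
pose d j : {linear Q j.+1 -> Q j} := match j return {linear Q j.+1 -> Q j} with
  | 0 => zX | 1 => res_aug P | j'.+2 => res_diff P j' end.
pose J j : lmodType A := match j with 0 => Z | 1 => N | j'.+2 => I j' end.
pose e j : {linear J j -> J j.+1} := match j return {linear J j -> J j.+1} with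
  | 0 => zN | 1 => cores_aug I | j'.+2 => cores_diff I j' end.
have exQ j : exact_at (d j.+1) (d j).
  case: j => [|[|j]] v; [|exact: res_exact0|exact: res_exact].
  by split=> [_|_]; [apply: res_aug_surj|apply: Z0].
have exJ j : exact_at (e j) (e j.+1).
  case: j => [|[|j]] v; [|exact: cores_exact0|exact: cores_exact].
  split=> [/= v0|[u <-]]; last by rewrite (Z0 u) !linear0.
  by exists 0; apply: (cores_aug_inj I); rewrite v0 !linear0.
have := hom_acyclic_balance exQ exJ (res_class P) (cores_injective I) i.+2 0.
rewrite addn0 => bal; split=> [H f f0|H f fc].
  have /bal.1 K : hom_acyclic d e i.+2 0.
    move=> g g0; have [|h hP] := H g.
      by move=> x; apply: (cores_aug_inj I); rewrite linear0; apply: g0.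
    have [v _] := exists_zero_linear (Q i.+3) Z.
    by exists h, v => x; rewrite (Z0 (v x)) linear0 addr0; apply: hP.
  have [u [v uv]] := K f (fun x => f0 (res_aug P x)).
  by exists v => x; rewrite uv (Z0 (d 0%N x)) linear0 add0r.
have /bal.2 K : hom_acyclic d e 0 i.+2.
  move=> g g0; have [x|v gv] := H g.
    by have [y <-] := res_aug_surj P x; apply: g0.
  have [u _] := exists_zero_linear Z (J i.+3).
  by exists u, v => x; rewrite (Z0 (d 0%N x)) linear0 add0r; apply: gv.
have [x|u [v uv]] := K f.
  by rewrite [f _]fc linear0.
by exists u => x; rewrite uv (Z0 (v x)) linear0 addr0.
Qed.

Lemma simple_into_essential (S U V : lmodType A) (f : {linear S -> V})
    (g : {linear U -> V}) :
  simple_module S -> essential_image g -> forall x, exists u, g u = f x.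
Proof.
move=> sS /essential_imageP eg x.
have [fx0|/eqP fx0] := pselect (f x = 0); first by exists 0; rewrite fx0 linear0.
have [a [[u gu] ax0]] := eg (f x) Logic.I fx0.
have ax0' : a *: x != 0 by apply: contra_neq ax0 => ax; rewrite -linearZ ax linear0.
have [b xb] := simple_cyclic sS ax0' x.
by exists (b *: u); rewrite linearZ gu -linearZ -linearZ -xb.
Qed.

(* Minimality makes the differentials of Hom(S, I) vanish. *)
Lemma ext_min_coresolution (S N : lmodType A) (P : resolution (@projective_module A) S)
    (I : min_inj_coresolution N) i : simple_module S ->
  (forall f : {linear P i -> N}, cocycle f -> coboundary f) <->
  (forall (f : {linear S -> I i}) x, f x = 0).
Proof.
move=> sS; case: i => [|i].
  split=> [H f x|H f fc].
    have [y|g gP] := linear_lift_inj (cores_aug_inj I) (f := f).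
      exact: simple_into_essential (cores_aug_min I) y.
    rewrite -gP; have [y <-] := res_aug_surj P x.
    rewrite (_ : g _ = 0) ?linear0 //; apply: (H (g \o res_aug P)) => z /=.
    by rewrite (_ : res_aug P _ = 0) ?linear0 //; apply/res_exact0; exists z.
  have [y|g gP] := linear_factor (res_aug_surj P) (k := f).
    by move=> /(res_exact0 P)[z <-]; apply: fc.
  move=> x; rewrite -gP; apply: (cores_aug_inj I); rewrite linear0.
  exact: (H (cores_aug I \o g)).
have dE k (f : {linear S -> I k}) x : cores_diff I k (f x) = 0.
  case: k f => [|k] f.
    exact/cores_exact0/(simple_into_essential f sS (cores_aug_min I)).
  exact/cores_exact/(simple_into_essential f sS (cores_min I k)).
rewrite (ext_coresolution P I i); split=> [H f x|H f _].
  by have [|v ->] := H f; [apply: dE|apply: dE].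
have [v v0] := exists_zero_linear S (I i); exists v => x.
by rewrite v0 linear0.
Qed.

Definition finitely_generated (V : lmodType A) : Prop :=
  exists s : seq V, forall x, spanned s x.

Lemma simple_finitely_generated (S : lmodType A) :
  simple_module S -> finitely_generated S.
Proof.
move=> sS; have [[x x0] _] := sS; exists [:: x] => y.
have [a ->] := simple_cyclic sS x0 y.
exact: submodZ (submod_spanned _) (spanned_mem (mem_head _ _)).
Qed.

Lemma exists_finite_cover (V : lmodType A) (s : seq V) :
  exists (P : lmodType A) (p : {linear P -> V}),
    [/\ projective_module P, finitely_generated P
      & forall x, spanned s x <-> exists y, p y = x].
Proof.
have [F [d [c fb]]] := exists_free A 'I_(size s).
have [p pd] := free_lift (tnth (in_tuple s)) fb.
exists F, p; split; first exact: free_projective fb.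
  exists [seq d i | i <- enum 'I_(size s)] => f; have [r [_ _ ->]] := fb.1 f.
  apply: submod_sum => [|i _]; first exact: submod_spanned.
  apply: submodZ; first exact: submod_spanned.
  by apply: spanned_mem; apply/mapP; exists i; rewrite ?mem_enum.
have sI := submod_im p (@submod_setT _ F).
move=> x; split=> [sx|[y <-]].
  have [|y _ ->] := spanned_sub sI _ sx; last by exists y.
  by move=> z /(tnthP (in_tuple s))[i ->]; exists (d i) => //; rewrite pd.
apply: (free_lift_onto (submod_spanned s) _ fb) => i.
by rewrite pd; apply/spanned_mem/mem_tnth.
Qed.

Lemma next_finite_syzygy (U V : lmodType A) (d : {linear U -> V}) :
  left_dcc A -> finitely_generated U ->
  exists (P : lmodType A) (e : {linear P -> U}),
    [/\ projective_module P, finitely_generated P & exact_at e d].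
Proof.
move=> dccA [s sU].
have sK := submod_preim d (submod_set0 V).
have [s' s'K Ks'] := submod_finitely_generated dccA sK (fun x _ => sU x).
have [P [e [projP fP eP]]] := exists_finite_cover s'.
exists P, e; split=> // v; split=> [/Ks'/eP//|/eP sv].
exact: (spanned_sub sK s'K sv).
Qed.

Lemma exists_finite_resolution (X : lmodType A) : left_dcc A ->
  finitely_generated X ->
  exists P : resolution (@projective_module A) X, forall i, finitely_generated (P i).
Proof.
move=> dccA [s sX]; have [P0 [p [projP0 fP0 pP]]] := exists_finite_cover s.
pose good (d : arrow A) := finitely_generated (asource d).
have H (d : {d | good d}) : exists n : {P : lmodType A & {linear P -> asource (sval d)}},
    [/\ projective_module (tag n), good (Arrow (tagged n))
      & exact_at (tagged n) (amap (sval d))].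
  case: d => d /= fd; have [P [e [? fP ?]]] := next_finite_syzygy (amap d) dccA fd.
  by exists (Tagged (fun P : lmodType A => {linear P -> asource d}) e).
have good_next d : good (Arrow (tagged (projT1 (cid (H d))))).
  by have [_ ? _] := projT2 (cid (H d)).
pose next d : {d | good d} := exist good _ (good_next d).
have good0 : good (Arrow p) by [].
pose x n := iter n next (exist good _ good0).
pose dx n : {linear asource (sval (x n.+1)) -> asource (sval (x n))} :=
  tagged (projT1 (cid (H (x n)))).
have dxP n : [/\ projective_module (asource (sval (x n.+1))),
    good (sval (x n.+1)) & exact_at (dx n) (amap (sval (x n)))].
  exact: projT2 (cid (H (x n))).
unshelve eexists.
  apply: (@Resolution A _ X (fun n => asource (sval (x n))) dx p).
  - by case=> [|i]; [exact: projP0|have [] := dxP i].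
  - by move=> y; apply/pP.
  - by have [_ _ ?] := dxP 0%N.
  - by move=> i; have [_ _ ?] := dxP i.+1.
by case=> [|i] /=; [exact: fP0|have [] := dxP i].
Qed.

Definition hom_exact (X M : lmodType A) (P : resolution (@projective_module A) X) i :=
  forall f : {linear P i -> M}, cocycle f -> coboundary f.
Arguments hom_exact {X} M P i.

(** [F] may be arbitrarily large: as [P i] is finitely generated, [f] is a finite combination of its
    coordinates [c t \o f]. These are cocycles with values in [A], and their primitives recombine to
    one for [f]. *)
Lemma hom_exact_projective (X F : lmodType A)
    (P : resolution (@projective_module A) X) i :
  finitely_generated (P i) -> projective_module F ->
  hom_exact A^o P i -> hom_exact F P i.
Proof.
move=> [s sP] /projective_dual_basis[c cP] H f fc.
have /choice[r rP] := cP.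
pose r' := undup (flatten [seq r (f x) | x <- s]).
have fE x : f x = \sum_(t <- r') (c t (f x) : A) *: t.
  have sF : submod [set x | f x = \sum_(t <- r') (c t (f x) : A) *: t].
    split; first by rewrite /= linear0 big1 // => t _; rewrite linear0 scale0r.
    move=> a y z /= fy fz; rewrite [LHS]linearP {1}fy {1}fz scaler_sumr -big_split.
    by apply: eq_bigr => t _ /=; rewrite !linearP scalerDl scalerA.
  apply: (spanned_sub sF _ (sP x)) => y ys; apply: rP; first exact: undup_uniq.
  move=> t tr; rewrite mem_undup; apply/flattenP; exists (r (f y)) => //.
  by apply/mapP; exists y.
have cf t : coboundary (c t \o f).
  by apply: H => x /=; rewrite fc linear0.
case: i f {H} s sP fc @r' fE cf => [|i] f s sP fc r' fE cf.
  by move=> x; rewrite fE big1 // => t _; rewrite [c t _]cf scale0r.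
have /choice[g gP] := cf.
have [|h hE] := @exists_linear _ _ F (fun x => \sum_(t <- r') (g t x : A) *: t).
  move=> a x y; rewrite scaler_sumr -big_split.
  by apply: eq_bigr => t _ /=; rewrite !linearP scalerDl scalerA.
by exists h => x; rewrite fE hE; apply: eq_bigr => t _; rewrite -gP.
Qed.

Lemma coboundary_comp (X M N : lmodType A) (P : resolution (@projective_module A) X) i
    (f : {linear P i -> M}) (p : {linear M -> N}) (g : {linear P i -> N}) :
  coboundary f -> (forall x, p (f x) = g x) -> coboundary g.
Proof.
case: i f g => [|i] f g /=.
  by move=> f0 fg x; rewrite -fg f0 linear0.
by move=> [u fu] fg; exists (p \o u) => x; rewrite -fg fu.
Qed.

(* Dimension shifting along a finite projective resolution of [M]. *)
Lemma hom_exact_pd_le (X M : lmodType A) (P : resolution (@projective_module A) X) m j :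
  (forall i, finitely_generated (P i)) ->
  (forall i, (i <= j + m)%N -> hom_exact A^o P i) -> pd_le m M -> hom_exact M P j.
Proof.
move=> fP; elim: m M j => [|m IHm] M j H /=.
  by move=> projM; apply: hom_exact_projective => //; apply: H; rewrite addn0.
move=> [K [F [i [p [projF [i_inj p_surj exp] HK]]]]] f fc.
have Fj : hom_exact F P j.
  by apply: hom_exact_projective => //; apply: H; rewrite leq_addr.
have Kj : hom_exact K P j.+1 by apply: IHm => // k; rewrite addSnnS; apply: H.
have dd x : res_diff P j (res_diff P j.+1 x) = 0 by apply/(res_exact P); exists x.
(* The connecting map: a lift [g] of [f] to [F] has [g d] with values in [K], a cocycle in degree
   [j.+1]. A primitive [h] of it corrects [g] to a cocycle in [F]. *)
have [g gP] := (@res_class _ _ _ P j) _ _ p f p_surj.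
have [x|k kP] := linear_lift_inj i_inj (f := g \o res_diff P j).
  by apply/exp; rewrite /= gP fc.
have [|h hP] := Kj k; first by move=> x; apply: i_inj; rewrite kP /= dd !linear0.
have pi x : p (i x) = 0 by apply/exp; exists x.
have cb : coboundary (g \- (i \o h)).
  by apply: Fj => x; rewrite /= -hP kP subrr.
apply: (coboundary_comp (p := p) cb) => x.
by rewrite /= linearB pi subr0 gP.
Qed.

End Ext.

(** * The equivalence *)

Lemma leastP (P : nat -> Prop) :
  least P = +oo%E \/ exists2 n, least P = EFin n%:Z & P n.
Proof.
rewrite /least; case: pselect => [exP|_]; [right|by left].
by case: ex_minnP => n /asboolP Pn _; exists n.
Qed.

Section Main.
Variable A : pzRingType.
Hypothesis dccA : left_dcc A.

(** A left ideal is finitely generated, so along a chain a map from it takes its values in a single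
    [D k]. *)
Lemma baer_bigcup (V : lmodType A) (K : Type) (C : set K) (D : K -> set V) :
  (exists k, C k) -> (forall k, C k -> submod (D k)) ->
  (forall k l, C k -> C l -> D k `<=` D l \/ D l `<=` D k) ->
  (forall k, C k -> baer (D k)) -> baer (\bigcup_(k in C) D k).
Proof.
move=> [k0 Ck0] sD totD bD L g sL gD lg.
have [s sLs Ls] := left_noetherian dccA sL.
have [k Ck gk] : exists2 k, C k & forall a, a \in s -> D k (g a).
  elim: s {Ls} sLs => [|a s IHs] sLs; first by exists k0.
  have [b bs|k Ck gk] := IHs; first by apply: sLs; rewrite inE bs orbT.
  have [l Cl gl] := gD a (sLs a (mem_head _ _)).
  have [kl|lk] := totD k l Ck Cl.
    by exists l => // b; rewrite inE => /orP[/eqP->//|/gk/kl].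
  by exists k => // b; rewrite inE => /orP[/eqP->|/gk//]; apply: lk.
have g0 := partial_linear0 sL lg.
pose L' := [set a | L a /\ D k (g a)].
have sL' : submod L'.
  split; first by split; [exact: (submod0 sL)|rewrite g0; exact: (submod0 (sD k Ck))].
  move=> c a b [La ga] [Lb gb]; split; first exact: (sL.2 c).
  by rewrite lg //; apply: ((sD k Ck).2 c).
have [a La|u Du gu] := bD k Ck L g sL _ lg; last by exists u; [exists k|].
suff [] : L' a by [].
by apply: (spanned_sub sL' _ (Ls a La)) => b bs; split; [apply: sLs|apply: gk].
Qed.

(* Maximal partial lift whose domain is injective; by the Noetherian property
   such domains are stable under unions of chains. *)
Lemma pd_le_of_hulls (E : lmodType A) g : injective_module E ->
  (forall (S W : lmodType A) (i : {linear S -> E})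
     (f : {linear S -> W}), simple_module S -> injective i ->
     injective_envelope f -> pd_le g W) ->
  pd_le g E.
Proof.
move=> injE HW; apply/pd_le_lifts => N E' C j0 q injE' sq cN f.
pose dom (G : set (E * E')) := [set x | exists e, G (x, e)].
pose P (G : set (E * E')) := [/\ forall e, G (0, e) -> e = 0,
  forall x e, G (x, e) -> q e = f x & baer (dom G)].
have [|F [G0 FG0] FP totF|G [sG _ [G00 Gq bG] maxG]] :=
    @submod_zorn _ _ P _ (@submod_set0 _ _).
- split=> [e [->]//|x e [-> ->]|L h sL hL lh]; first by rewrite !linear0.
  exists 0 => [|a La]; first by exists 0.
  by rewrite scaler0; have [e []] := hL a La.
- split=> [e [G FG Ge]|x e [G FG Gxe]|].
  + by have [_ _ [G00 _ _]] := FP G FG; apply: G00.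
  + by have [_ _ [_ Gq _]] := FP G FG; apply: Gq.
  + have -> : dom (\bigcup_(G in F) G) = \bigcup_(G in F) dom G.
      apply/seteqP; split=> [x [e [G FG Gxe]]|x [G FG [e Gxe]]].
        by exists G => //; exists e.
      by exists e, G.
    apply: baer_bigcup; first by exists G0.
    * by move=> G FG; have [sG _ _] := FP G FG; apply: submod_dom.
    * move=> G H FG FH; have [GH|HG] := totF G H FG FH.
        by left=> x [e /GH ?]; exists e.
      by right=> x [e /HG ?]; exists e.
    * by move=> G FG; have [_ _ []] := FP G FG.
have lG : linear_graph G by [].
have sU := submod_dom sG; set U := [set x | _] in sU.
have [|k kG] := linear_graph_total lG; last by exists k => x; apply: Gq (kG x).
move=> x; apply: contrapT => nUx.
have [h hU hid] := baer_retract sU bG.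
(* As [h] is a retraction onto the domain [U], this element lies in the complement [ker h]. A simple
   submodule below it, and therefore also its hull [D], meets [U] only in 0. *)
have w0 : x - h x != 0.
  by apply/eqP => /eqP; rewrite subr_eq0 => /eqP xh; apply: nUx; rewrite xh; apply: hU.
have [S [i [sS i_inj iw]]] := exists_simple_submodule dccA w0.
have sX := submod_im i (@submod_setT _ S).
have XE : [set y | exists2 s, [set: S] s & y = i s] = [set y | exists s, i s = y].
  by apply/seteqP; split=> y [s]; [exists s|exists s].
rewrite XE in sX; have [D [sD XD eD bD]] := exists_hull injE sX.
have UD0 y : U y -> D y -> y = 0.
  move=> Uy Dy; apply: contrapT => /eqP y0; have [a [[s iay] ay0]] := eD y Dy y0.
  have hay : h (a *: y) = a *: y by apply: hid; apply: submodZ.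
  move/eqP: ay0; apply; rewrite -hay -iay; have [b ->] := iw s.
  by rewrite linearZ linearB /= (hid (h x)) // subrr scaler0.
have [W [j [j_inj jD]]] := exists_submodule sD.
have [f' _ envf'] := hull_envelope i_inj j_inj jD XD eD bD.
have /pd_le_lifts HWW := HW _ _ i f' sS i_inj envf'.
have [k kP] := HWW _ _ _ _ _ injE' sq cN (f \o j).
(* The lift over [D]. Added to [G], it has the direct sum of [U] and [D] as its domain, again
   injective, so maximality would force the nonzero [D] into [U]. *)
pose H := [set p : E * E' | exists w, p = (j w, k w)].
have sH : submod H.
  split; first by exists 0; rewrite !linear0.
  by move=> a _ _ [v ->] [v' ->]; exists (a *: v + v'); rewrite !linearP.
have GH : sumset G H `<=` G.
  apply: maxG; [exact: submod_sumset|by move=> p Gp; apply: sumset_l|split].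
  - move=> e [[u e1] [_ [Gu [v ->] [uv ->]]]].
    have jv : j v = 0.
      apply: UD0; last by apply/jD; exists v.
      have -> : j v = - u by apply/eqP; rewrite -addr_eq0 addrC -uv.
      by apply: submodN => //; exists e1.
    have v0 : v = 0 by apply: j_inj; rewrite jv linear0.
    rewrite v0 linear0 addr0; apply: G00.
    by rewrite uv jv addr0.
  - move=> y e [[u e1] [_ [Gu [v ->] [-> ->]]]].
    by rewrite !linearD /= (Gq _ _ Gu) kP.
  - have -> : dom (sumset G H) = sumset U D; last exact: baer_sumset.
    apply/seteqP; split=> [y [e [[u e1] [_ [Gu [v ->] [-> _]]]]]|].
      by exists u, (j v); split=> //; [exists e1|apply/jD; exists v].
    move=> _ [u [_ [[e1 Gu] /jD[v <-] ->]]].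
    by exists (e1 + k v), (u, e1), (j v, k v); split=> //; exists v.
have [[s s0] _] := sS; have js : j (f' s) != 0.
  have [_ f'_inj _] := envf'; apply: contra_neq s0 => js.
  by apply: f'_inj; apply: j_inj; rewrite js !linear0.
move/eqP: js; apply; apply: UD0; last by apply/jD; exists (f' s).
exists (k (f' s)); apply: GH; apply: sumset_r => //.
by exists (f' s).
Qed.

Lemma Ext_nonzeroP (S N : lmodType A)
    (P : resolution (@projective_module A) S) i :
  ~ hom_exact N P i -> Ext_nonzero i S N.
Proof.
move=> nH; apply: contrapT => nE; apply: nH => f fc.
by apply: contrapT => fb; apply: nE; exists P, f.
Qed.

Lemma grade_le_pd (S E : lmodType A) (f : {linear S -> E}) m :
  simple_module S -> injective f -> pd_le m E -> (grade S <= EFin m%:Z)%E.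
Proof.
move=> sS f_inj HE; apply/least_leP.
have [P fP] := exists_finite_resolution dccA (simple_finitely_generated sS).
apply: contrapT => nE.
have H : hom_exact E P 0.
  apply: (hom_exact_pd_le (m := m)) => // i im; apply: contrapT => /Ext_nonzeroP Ei.
  by apply: nE; exists i.
have [[x x0] _] := sS; have [y py] := res_aug_surj P x.
move/eqP: x0; apply; apply: f_inj; rewrite linear0 -py; apply: (H (f \o res_aug P)).
by move=> z /=; rewrite (_ : res_aug P _ = 0) ?linear0 //; apply/res_exact0; exists z.
Qed.

Lemma simple_map_injective (S V : lmodType A) (f : {linear S -> V}) x :
  simple_module S -> f x <> 0 -> injective f.
Proof.
move=> sS fx; apply: linear_eq0_inj => y fy; apply: contrapT => /eqP y0.
have [a xa] := simple_cyclic sS y0 x.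
by apply: fx; rewrite xa linearZ /= fy scaler0.
Qed.

Lemma envelope_pd_le (S E : lmodType A) (f : {linear S -> E})
    (I : min_inj_coresolution A^o) g :
  simple_module S -> injective_envelope f -> Ext_nonzero g S A^o ->
  pd_le g (I g) -> pd_le g E.
Proof.
move=> sS [injE f_inj ef] [P [c [cc cb]]] HI.
have [h [x hx]] : exists (h : {linear S -> I g}) x, h x <> 0.
  apply: contrapT => nh; apply: cb; move: c cc; apply/(ext_min_coresolution P I g sS).
  by move=> h x; apply: contrapT => hx; apply: nh; exists h, x.
have h_inj := simple_map_injective sS hx.
have [e eP] := (@cores_injective _ _ I g) _ _ f h f_inj.
have e_inj : injective e.
  apply: (essential_inj ef) => y; rewrite eP => hy.
  by rewrite (h_inj y 0) ?linear0 // hy linear0.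
have [r rP] := injE _ _ e idfun e_inj.
exact: pd_le_retract rP HI.
Qed.

Lemma Gorenstein_grade n : n_Gorenstein A n ->
  forall (S I : lmodType A) (f : {linear S -> I}),
    simple_module S -> injective_envelope f ->
    (Order.min (EFin n%:Z) (pdim I) <= grade S)%E.
Proof.
(* [n_Gorenstein] speaks of every minimal coresolution, so one has to be exhibited before it yields
   anything. *)
move=> gor S I f sS envf; have [J] := exists_min_inj_coresolution A^o.
rewrite /grade.
have [->|[g gE Eg]] := leastP (fun i => Ext_nonzero i S A^o); first exact: leey.
rewrite gE ge_min lee_fin lez_nat; have [//|gn /=] := leqP n g.
apply/pdim_leP; apply: (envelope_pd_le (I := J) sS envf Eg).
by apply/fdim_leP => //; apply: gor.
Qed.

Lemma grade_pdim n :
  (forall (S I : lmodType A) (f : {linear S -> I}),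
    simple_module S -> injective_envelope f ->
    (Order.min (EFin n%:Z) (pdim I) <= grade S)%E) ->
  forall (S I : lmodType A) (f : {linear S -> I}),
    simple_module S -> injective_envelope f ->
    (grade S < EFin n%:Z)%E -> pdim I = grade S.
Proof.
move=> H S I f sS envf gn; have [injI f_inj _] := envf.
(* With the grade below [n], the minimum can only be attained by [pdim I], which gives one
   inequality; [grade_le_pd] gives the other when [pdim I] is finite. *)
have := H S I f sS envf; rewrite ge_min leNgt gn /= => pg.
apply/eqP; rewrite eq_le pg /=.
have [pE|[m pE _]] : pdim I = +oo%E \/ exists2 m : nat, pdim I = EFin m%:Z & _ := leastP _.
  by rewrite pE leey.
by rewrite pE; apply: (grade_le_pd sS f_inj); apply/pdim_leP; rewrite pE.
Qed.

Lemma grade_Gorenstein n :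
  (forall (S I : lmodType A) (f : {linear S -> I}),
    simple_module S -> injective_envelope f ->
    (grade S < EFin n%:Z)%E -> pdim I = grade S) ->
  n_Gorenstein A n.
Proof.
move=> H I g gn; apply/fdim_leP => //.
apply: pd_le_of_hulls => [|S W i f sS i_inj envf]; first exact: cores_injective.
have [P _] := exists_finite_resolution dccA (simple_finitely_generated sS).
(* [S] embeds in [I g], so Ext^g(S, A) is nonzero. With [g < n] this places [S] within reach of the
   hypothesis, whose equality then bounds [pdim W] by [g]. *)
have gradeS : (grade S <= EFin g%:Z)%E.
  apply/least_leP; exists g => //; apply: (@Ext_nonzeroP S _ P).
  move=> /(ext_min_coresolution P I g sS) H0.
  have [[x /eqP x0] _] := sS; apply: x0; apply: i_inj.
  by rewrite H0 linear0.
apply/pdim_leP; rewrite (H S W f) //.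
by apply: le_lt_trans gradeS _; rewrite lte_fin ltz_nat.
Qed.

End Main.

Theorem theorem3p5 (A : pzRingType) (n : nat) (hA : artin_algebra A) :
  [<-> n_Gorenstein A n;
       forall (S I : lmodType A) (f : {linear S -> I}),
         simple_module S -> injective_envelope f ->
         (Order.min (EFin n%:Z) (pdim I) <= grade S)%E;
       forall (S I : lmodType A) (f : {linear S -> I}),
         simple_module S -> injective_envelope f ->
         (grade S < EFin n%:Z)%E -> pdim I = grade S].
Proof.
have dccA := artin_algebra_left_dcc hA; tfae.
- exact: Gorenstein_grade.
- exact: grade_pdim.
- exact: grade_Gorenstein.
Qed.
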